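(* Let $q$ be a power of a prime $p$ and let $k$ be a positive integer. Let $\mathcal{G}_k=(\mathcal{G}_{k,1},\mathcal{G}_{k,2})$, with $\mathcal{G}_{k,1},\mathcal{G}_{k,2}\in\mathbb{Z}[x,y]$, be the $k$-th bivariate folding polynomial map associated with the Lie algebra $G_2$, i.e. the unique polynomial map satisfying $\mathcal{G}_k(\varPhi(\sigma,\tau))=\varPhi(k\sigma,k\tau)$ for all $\sigma,\tau\in\mathbb{C}$, where $\varPhi=(\varphi_1,\varphi_2)$ is given by \[\varphi_1(\sigma,\tau)=e^{2\pi i\sigma}+e^{2\pi i\tau}+e^{2\pi i(\sigma+\tau)}+e^{-2\pi i\sigma}+e^{-2\pi i\tau}+e^{-2\pi i(\sigma+\tau)},\] \[\varphi_2(\sigma,\tau)=e^{2\pi i(2\sigma+\tau)}+e^{2\pi i(\sigma+2\tau)}+e^{2\pi i(\sigma-\tau)}+e^{-2\pi i(2\sigma+\tau)}+e^{-2\pi i(\sigma+2\tau)}+e^{-2\pi i(\sigma-\tau)}.\] Let $\bar{\mathcal{G}}_k:\mathbb{F}_q^2\to\mathbb{F}_q^2$ be the map induced by reducing the integer coefficients modulo $p$. Set \[a=\frac{q-1}{\gcd(q-1,k)},\quad \tilde a=\frac{q+1}{\gcd(q+1,k)},\quad b=\frac{q^2-1}{\gcd(q^2-1,k)},\] \[c=\frac{q^2+q+1}{\gcd(q^2+q+1,k)},\quad \tilde c=\frac{q^2-q+1}{\gcd(q^2-q+1,k)},\] and $a'=\gcd(a,2)$, $\tilde a'=\gcd(\tilde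 a,2)$. Then \[\left|\bar{\mathcal{G}}_k(\mathbb{F}_q^2)\right|=\frac{a^2}{12}+\frac{\tilde a^2}{12}+\frac{b}{2}+\frac{c}{6}+\frac{\tilde c}{6}+\eta(k,q),\] where $\eta(k,q)$ is given as follows: \begin{itemize} \item if ($2\nmid k$ or $2\nmid b$) and ($3\nmid k$ or $3\nmid a\tilde a$), then $\eta(k,q)=0$; \item if ($2\nmid k$ or $2\nmid b$) and ($3\mid k$ and $3\mid a\tilde a$), then $\eta(k,q)=1/3$; \item if ($2\mid k$ and $2\mid b$) and ($3\nmid k$ or $3\nmid a\tilde a$), then $\eta(k,q)=(a+\tilde a)/2-1/(2a'\tilde a')$; \item if ($2\mid k$ and $2\mid b$) and ($3\mid k$ and $3\mid a\tilde a$), then $\eta(k,q)=(a+\tilde a)/2-1/(2a'\tilde a')+1/3$. \end{itemize} In particular, if $\gcd(k,6)=1$, then $\eta(k,q)=0$.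
   Context: The value set of a map $f:\mathbb{F}_q^2\to\mathbb{F}_q^2$ is its image $f(\mathbb{F}_q^2)$. The polynomial maps $\mathcal{G}_k$ (folding polynomials of $G_2$) exist, are unique, and have integer coefficients. *)

(* Defs.v *)
From mathcomp Require Import all_boot all_order all_algebra.
From mathcomp Require Import polyXY.
From mathcomp Require Import reals sequences exp trigo.
From mathcomp Require Import complex.

Set Implicit Arguments.
Unset Strict Implicit.
Unset Printing Implicit Defensive.

Import GRing.Theory Num.Theory.
Local Open Scope ring_scope.

Section ComplexExponential.
Variable R : realType.

Definition cexp (z : R[i]) : R[i] :=
  Complex (expR (complex.Re z) * cos (complex.Im z))
          (expR (complex.Re z) * sin (complex.Im z)).

(* e^(2 pi i z) *)
Definition e2pii (z : R[i]) : R[i] := cexp (Complex 0 (2 * pi) * z).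

Definition phi1 (s t : R[i]) : R[i] :=
  e2pii s + e2pii t + e2pii (s + t)
  + e2pii (- s) + e2pii (- t) + e2pii (- (s + t)).

Definition phi2 (s t : R[i]) : R[i] :=
  e2pii (2 * s + t) + e2pii (s + 2 * t) + e2pii (s - t)
  + e2pii (- (2 * s + t)) + e2pii (- (s + 2 * t)) + e2pii (- (s - t)).

Definition Phi (s t : R[i]) : R[i] * R[i] := (phi1 s t, phi2 s t).

End ComplexExponential.

(* An element of Z[x, y] is a {poly {poly int}}, the outer indeterminate being
   x and the inner one y, as in the polyXY notation u.[x, y]. Through the
   canonical map Z -> K, a pair of such polynomials induces a map K^2 -> K^2;
   in characteristic p this reduces the coefficients modulo p. *)
Definition polymap (K : comNzRingType)
    (G : {poly {poly int}} * {poly {poly int}}) (v : K * K) : K * K :=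
  ((map_poly (map_poly intr) G.1).[v.1, v.2],
   (map_poly (map_poly intr) G.2).[v.1, v.2]).

(* The property that characterizes the k-th folding polynomial map of G_2. *)
Definition is_G2_folding (R : realType) (k : nat)
    (G : {poly {poly int}} * {poly {poly int}}) : Prop :=
  forall s t : R[i], polymap G (Phi s t) = Phi (k%:R * s) (k%:R * t).

Section ValueSetFormula.
Variables k q : nat.

Local Notation reduced m := (m %/ gcdn m k)%N.

(* at_, ct_, at'_ are the quantities written with a tilde *)
Definition a_ : nat := reduced (q - 1)%N.
Definition at_ : nat := reduced (q + 1)%N.
Definition b_ : nat := reduced (q ^ 2 - 1)%N.
Definition c_ : nat := reduced (q ^ 2 + q + 1)%N.
(* q <= q ^ 2, so that the subtraction is never truncated *)
Definition ct_ : nat := reduced (q ^ 2 - q + 1)%N.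
Definition a'_ : nat := gcdn a_ 2.
Definition at'_ : nat := gcdn at_ 2.

Definition eta : rat :=
  let two_part : rat := (a_%:R + at_%:R) / 2 - 1 / (2 * a'_%:R * at'_%:R) in
  match (2 %| k)%N && (2 %| b_)%N, (3 %| k)%N && (3 %| a_ * at_)%N with
  | false, false => 0
  | false, true => 1 / 3
  | true, false => two_part
  | true, true => two_part + 1 / 3
  end.

End ValueSetFormula.

(* Main.v *)
(* In the coordinates u = e^(2 pi i s), v = e^(2 pi i t) the map Phi is the
   quotient of the two-dimensional torus by the Weyl group W of G_2, which has
   order 12, and the folding map is induced by the k-th power map of the torus;
   this identity has integer coefficients, so it holds over every field.

   Over an algebraic closure of F_q, a point of F_q^2 is the image of a torus
   point r with q r = w r (additively) for some w in W. Such points lie in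
   (Z/N)^2 with N = q^6 - 1. Hence the value set is the set of W-orbits in
   S = U_w k T_w, where T_w = ker (q - w), and twelve times its cardinality is
   the sum over s in S of the order of the stabilizer of s. This is compared with
   the sum over w of the order of k T_w, which is a^2 + a~^2 + 6 b + 2 c + 2 c~.
   The summands agree except at some points fixed by a reflection, and the
   differences there make up eta. *)

Require Import Defs.
From mathcomp Require Import all_boot all_order all_algebra all_solvable all_field.
From mathcomp Require Import polyXY.
From mathcomp Require Import reals sequences exp trigo complex.
From mathcomp Require Import ring lra zify.

Set Implicit Arguments.
Unset Strict Implicit.
Unset Printing Implicit Defensive.

Import Order.TTheory GRing.Theory Num.Theory.

(** * Arithmetic of the reduced orders *)

Lemma gcdn2r a : gcdn a 2 = if (2 %| a)%N then 2 else 1%N.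
Proof.
case: ifP => [/gcdn_idPr //|a2]; have := dvdn_gcdl a 2; have := dvdn_gcdr a 2.
have : (0 < gcdn a 2)%N by rewrite gcdn_gt0 orbT.
by case: (gcdn a 2) => [|[|[|g]]] // _ /dvdn_leq // H; rewrite a2.
Qed.

Section Reduced.
Variables k q : nat.
Hypotheses (k_gt0 : (0 < k)%N) (q_gt1 : (1 < q)%N).
Local Notation reduced m := (m %/ gcdn m k)%N.

Lemma reduced_gt0 m : (0 < m)%N -> (0 < reduced m)%N.
Proof. by move=> m0; rewrite divn_gt0 ?gcdn_gt0 ?m0 // dvdn_leq ?dvdn_gcdl. Qed.

Lemma reduced_dvdl m : (reduced m %| m)%N.
Proof. by apply/dvdnP; exists (gcdn m k); rewrite mulnC divnK // dvdn_gcdl. Qed.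

Lemma dvd_reduced m m' : (0 < m')%N -> (m %| m')%N -> (reduced m %| reduced m')%N.
Proof.
move=> m'0 /dvdnP[c Em']; set g := gcdn m k; set g' := gcdn m' k.
have g'0 : (0 < g')%N by rewrite gcdn_gt0 m'0.
have /dvdnP[e Ee] : (g' %| c * g)%N.
  by rewrite muln_gcdr dvdn_gcd -Em' dvdn_gcdl dvdn_mull ?dvdn_gcdr.
have -> : m' = (m %/ g * e * g')%N.
  by rewrite -mulnA -Ee mulnCA divnK ?dvdn_gcdl.
by rewrite mulnK // dvdn_mulr.
Qed.

Lemma logn_reduced r m : (0 < m)%N -> logn r (reduced m) = (logn r m - logn r k)%N.
Proof.
by move=> m0; rewrite logn_div ?dvdn_gcdl // logn_gcd //; lia.
Qed.

Lemma dvdn_logn r m : prime r -> (0 < m)%N -> (r %| m)%N = (0 < logn r m)%N.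
Proof. by move=> pr m0; rewrite -[r in LHS]expn1 pfactor_dvdn. Qed.

Lemma prime_dvd_reduced r m : prime r -> (0 < m)%N ->
  (r %| reduced m)%N = (logn r k < logn r m)%N.
Proof. by move=> pr m0; rewrite dvdn_logn ?reduced_gt0 // logn_reduced // subn_gt0. Qed.

Let q1_gt0 : (0 < q - 1)%N. Proof. by rewrite subn_gt0. Qed.
Let q1'_gt0 : (0 < q + 1)%N. Proof. by rewrite addn1. Qed.
Let qq_gt0 : (0 < q ^ 2 - 1)%N. Proof. by rewrite subn_gt0 -(exp1n 2) ltn_exp2r. Qed.

Let c_gt0 : (0 < q ^ 2 + q + 1)%N. Proof. by rewrite addn1. Qed.
Let c'_gt0 : (0 < q ^ 2 - q + 1)%N. Proof. by rewrite addn1. Qed.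

Let qqE : (q ^ 2 - 1 = (q - 1) * (q + 1))%N.
Proof. by rewrite -[1%N](exp1n 2) subn_sqr exp1n. Qed.

Lemma logn_qq r : logn r (q ^ 2 - 1) = (logn r (q - 1) + logn r (q + 1))%N.
Proof. by rewrite qqE lognM. Qed.

Lemma logn_odd_coprime r : prime r -> r != 2 -> logn r (q - 1) = 0%N \/ logn r (q + 1) = 0%N.
Proof.
move=> pr r2; case: (posnP (logn r (q - 1))) => [->|h1]; first by left.
case: (posnP (logn r (q + 1))) => [->|h2]; first by right.
move: h1 h2; rewrite -!dvdn_logn // => h1 h2.
have : (r %| 2)%N by rewrite -(dvdn_addr 2 h1); have -> : (q - 1 + 2 = q + 1)%N by lia.
by rewrite dvdn_prime2 // (negPf r2).
Qed.

Lemma logn2_cases : let al := logn 2 (q - 1) in let be := logn 2 (q + 1) in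
  [\/ al = 0 /\ be = 0, al = 1 /\ (1 < be) | (1 < al) /\ be = 1]%N.
Proof.
rewrite /=; have D m e : (0 < m)%N -> (2 ^ e %| m)%N = (e <= logn 2 m)%N.
  by move=> m0; rewrite pfactor_dvdn.
have := D _ 1%N q1_gt0; have := D _ 2%N q1_gt0; have := D _ 1%N q1'_gt0; have := D _ 2%N q1'_gt0.
rewrite !expn1 (_ : 2 ^ 2 = 4)%N // => E1 E2 E3 E4.
have [e|[e|[e|e]]] : (q %% 4 = 0 \/ q %% 4 = 1 \/ q %% 4 = 2 \/ q %% 4 = 3)%N by lia.
- by apply: Or31; lia.
- by apply: Or33; lia.
- by apply: Or31; lia.
- by apply: Or32; lia.
Qed.

Lemma dvd2_a : (2 %| a_ k q)%N = (logn 2 k < logn 2 (q - 1))%N.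
Proof. by rewrite /a_ prime_dvd_reduced. Qed.
Lemma dvd2_at : (2 %| at_ k q)%N = (logn 2 k < logn 2 (q + 1))%N.
Proof. by rewrite /at_ prime_dvd_reduced. Qed.
Lemma dvd2_b : (2 %| b_ k q)%N = (logn 2 k < logn 2 (q - 1) + logn 2 (q + 1))%N.
Proof. by rewrite /b_ prime_dvd_reduced // logn_qq. Qed.

Lemma gcd_b_reduced m : m = (q - 1)%N \/ m = (q + 1)%N ->
  gcdn (b_ k q) m = (reduced m * (if (2 %| k) && (2 %| b_ k q) then 2 else 1))%N.
Proof.
move=> Em; have m0 : (0 < m)%N by case: Em => ->.
have b0 : (0 < b_ k q)%N by rewrite reduced_gt0.
apply: eqn_from_log; first by rewrite gcdn_gt0 m0 orbT.
  by rewrite muln_gt0 reduced_gt0 //; case: ifP.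
move=> r; case: (boolP (prime r)) => [pr|npr]; last by rewrite lognE [in RHS]lognE (negPf npr).
rewrite logn_gcd // lognM ?reduced_gt0 //; last by case: ifP.
rewrite !logn_reduced // logn_qq dvd2_b dvdn_logn //.
case: (eqVneq r 2) => [->|r2].
  case: logn2_cases => -[al be]; rewrite /= (fun_if (logn 2)) logn1 (_ : logn 2 2 = 1)%N //;
    by move: Em => [] ->; case: ifP; lia.
have -> : logn r (if (0 < logn 2 k)%N && (logn 2 k < logn 2 (q - 1) + logn 2 (q + 1))%N
    then 2 else 1) = 0%N by case: ifP => _; rewrite ?logn1 // (@logn_prime r 2) // (negPf r2).
by have := logn_odd_coprime pr r2; move: Em => [] ->; lia.
Qed.

Lemma logn3_1 m : (m %% 9 = 3)%N -> logn 3 m = 1%N.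
Proof.
move=> Em; have m0 : (0 < m)%N by case: m Em.
have := @pfactor_dvdn 3 1 m isT m0; have := @pfactor_dvdn 3 2 m isT m0.
by rewrite expn1 (_ : 3 ^ 2 = 9)%N //; lia.
Qed.

Lemma logn3_0 m : (m %% 3 != 0)%N -> logn 3 m = 0%N.
Proof.
move=> m3; apply/eqP; rewrite -leqn0 leqNgt -dvdn_logn // lt0n.
by apply: contraNneq m3 => ->.
Qed.

Lemma three_mod1 : (q %% 3 = 1)%N ->
  [/\ (3 %| a_ k q)%N = (3 %| b_ k q)%N, (3 %| c_ k q)%N ==> (3 %| b_ k q)%N &
    (3 %| k)%N && (3 %| a_ k q * at_ k q)%N = (3 %| b_ k q)%N && ~~ (3 %| c_ k q)%N].
Proof.
move=> q3; have be0 : logn 3 (q + 1) = 0%N by apply: logn3_0; lia.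
have al0 : (0 < logn 3 (q - 1))%N by rewrite -dvdn_logn //; lia.
have c1 : logn 3 (q ^ 2 + q + 1) = 1%N.
  apply: logn3_1; have [t ->] : exists t, q = (3 * t + 1)%N by exists (q %/ 3)%N; lia.
  have -> : ((3 * t + 1) ^ 2 + (3 * t + 1) + 1 = (t * t + t) * 9 + 3)%N by ring.
  by rewrite modnMDl.
rewrite Euclid_dvdM // /a_ /at_ /b_ /c_ !prime_dvd_reduced // logn_qq be0 c1 dvdn_logn //.
by split; lia.
Qed.

Lemma three_mod2 : (q %% 3 = 2)%N ->
  [/\ (3 %| at_ k q)%N = (3 %| b_ k q)%N, (3 %| ct_ k q)%N ==> (3 %| b_ k q)%N &
    (3 %| k)%N && (3 %| a_ k q * at_ k q)%N = (3 %| b_ k q)%N && ~~ (3 %| ct_ k q)%N].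
Proof.
move=> q3; have al0 : logn 3 (q - 1) = 0%N by apply: logn3_0; lia.
have be0 : (0 < logn 3 (q + 1))%N by rewrite -dvdn_logn //; lia.
have c1 : logn 3 (q ^ 2 - q + 1) = 1%N.
  apply: logn3_1; have [t ->] : exists t, q = (3 * t + 2)%N by exists (q %/ 3)%N; lia.
  have -> : ((3 * t + 2) ^ 2 - (3 * t + 2) + 1 = (t * t + t) * 9 + 3)%N.
    have -> : ((3 * t + 2) ^ 2 = (3 * t + 2) + ((3 * t + 2) * (3 * t + 1)))%N by ring.
    by rewrite addKn; ring.
  by rewrite modnMDl.
rewrite Euclid_dvdM // /a_ /at_ /b_ /ct_ !prime_dvd_reduced // logn_qq al0 c1 dvdn_logn //.
by split; lia.
Qed.

(* Twelve times the corrections to the main term due to the points of order 2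
   and 3 amount to [- 3 * defect2] and [2 * defect3]. *)
Definition defect2 : nat :=
  (2 %| b_ k q) * (~~ (2 %| a_ k q) + ~~ (2 %| at_ k q)).
Definition defect3 : nat := 2 * ((3 %| k) && (3 %| a_ k q * at_ k q)).

Local Open Scope ring_scope.

Lemma value_set_formula (n : nat) (a := a_ k q) (a' := at_ k q) (b := b_ k q)
    (c := c_ k q) (c' := ct_ k q) :
  (12 * n + 3 * defect2 = a ^ 2 + 3 * b + 2 * c + (a' ^ 2 + 3 * b + 2 * c')
    + 6 * (gcdn b (q - 1) - a) + 6 * (gcdn b (q + 1) - a') + 2 * defect3)%N ->
  n%:R = a%:R ^+ 2 / 12 + a'%:R ^+ 2 / 12 + b%:R / 2 + c%:R / 6 + c'%:R / 6 + eta k q.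
Proof.
rewrite !gcd_b_reduced; [|by right|by left].
rewrite -/(a_ k q) -/(at_ k q) -/a -/a' -/b => E.
rewrite /eta /a'_ /at'_ !gcdn2r -/a -/a' -/b.
move: E; rewrite /defect2 /defect3 -/a -/a' -/b.
have k2 : (2 %| k)%N = (0 < logn 2 k)%N by rewrite dvdn_logn.
have := logn2_cases; have := dvd2_a; have := dvd2_at; have := dvd2_b.
rewrite /= -/a -/a' -/b => -> -> ->; rewrite k2 => L.
set k2b := _ && _.
have Ek2b : k2b =
  (0 < logn 2 k)%N && (logn 2 k < logn 2 (q - 1) + logn 2 (q + 1))%N by [].
set t := (3 %| k)%N && _.
set da := (logn 2 k < logn 2 (q - 1))%N; set da' := (logn 2 k < logn 2 (q + 1))%N.
set db := (_ < _ + _)%N.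
have Rel : if k2b then db && ~~ (da && da') else (db ==> da && da').
  by rewrite Ek2b /da /da' /db; move: L; clear => -[] [+ +]; case: ifP; lia.
move/(congr1 (fun m : nat => m%:R : rat)).
case: k2b {Ek2b} Rel => [/= /andP[-> Rel]|/=].
  rewrite !muln2 -!addnn !addnK.
  case: da da' Rel => [] [] // _; case: t; move=> /= E; rewrite !(natrD, natrM, natrX) /= in E; lra.
rewrite !muln1 !subnn.
by case: db => [/andP[-> ->]|_]; case: t; move=> /= E; rewrite !(natrD, natrM, natrX) /= in E; lra.
Qed.

End Reduced.

Local Open Scope ring_scope.

(** * Transfer of the folding identity to an arbitrary field *)

Section Exponential.
Variable R : realType.
Local Notation C := R[i].

Lemma cexpD (z w : C) : cexp (z + w) = cexp z * cexp w.
Proof.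
case: z w => [a b] [c d]; rewrite /cexp /= expRD cosD sinD.
by apply/eqP; rewrite eq_complex /=; apply/andP; split; apply/eqP; ring.
Qed.

Lemma e2piiD (z w : C) : e2pii (z + w) = e2pii z * e2pii w.
Proof. by rewrite /e2pii mulrDr cexpD. Qed.

Lemma e2pii0 : e2pii (0 : C) = 1.
Proof. by rewrite /e2pii mulr0 /cexp /= expR0 cos0 sin0 mulr0 mulr1. Qed.

Lemma e2pii_neq0 (z : C) : e2pii z != 0.
Proof.
apply/eqP => z0; have := e2pii0; rewrite -(subrr z) e2piiD z0 mul0r.
by move/eqP; rewrite eq_sym oner_eq0.
Qed.

Lemma e2piiN (z : C) : e2pii (- z) = (e2pii z)^-1.
Proof.
by apply: (mulIf (e2pii_neq0 z)); rewrite -e2piiD addNr e2pii0 mulVf ?e2pii_neq0.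
Qed.

Lemma e2piiMn (k : nat) (z : C) : e2pii (k%:R * z) = e2pii z ^+ k.
Proof.
elim: k => [|k IHk]; first by rewrite mul0r e2pii0.
by rewrite -natr1 mulrDl mul1r e2piiD IHk exprSr.
Qed.

Lemma e2pii_natr (m : nat) : (0 < m)%N -> exists z : C, e2pii z = m%:R.
Proof.
move=> m0; have pi0 : (pi : R) != 0 by rewrite gt_eqF ?pi_gt0.
have E (x y : R) : y != 0 -> 0 * 0 - 2 * y * (- x / (2 * y)) = x by move=> ?; field.
exists (Complex 0 (- (ln m%:R) / (2 * pi))); rewrite /e2pii /cexp /= E //.
rewrite mul0r mulr0 addr0 cos0 sin0 mulr0 mulr1 lnK ?posrE ?ltr0n //.
by rewrite (_ : (m%:R : C) = (m%:R)%:C%C) // rmorph_nat.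
Qed.

End Exponential.

Section TorusQuotient.
Variable K : fieldType.

(* The map Phi of Defs.v in the coordinates u = e2pii s, v = e2pii t. *)
Definition torus_phi (x : K * K) : K * K :=
  let: (u, v) := x in
  (u + v + u * v + u^-1 + v^-1 + (u * v)^-1,
   u ^+ 2 * v + u * v ^+ 2 + u / v
   + (u ^+ 2 * v)^-1 + (u * v ^+ 2)^-1 + v / u).

End TorusQuotient.

Arguments torus_phi {K} x : simpl never.

Lemma Phi_torus (R : realType) (s t : R[i]) :
  Phi s t = torus_phi (e2pii s, e2pii t).
Proof.
rewrite /Phi /phi1 /phi2 /torus_phi !(opprD, e2piiD, e2piiN, opprK, e2piiMn) !invfM.
by rewrite invrK [_^-1 * e2pii t]mulrC.
Qed.

(* The integer polynomial clearing the denominators does not depend on the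
   field, which is what transports an identity from R[i] to characteristic p. *)
Definition laurent (f : forall K : fieldType, K -> K -> K) : Prop :=
  exists (M : nat) (P : {poly {poly int}}), forall (K : fieldType) (u v : K),
    u != 0 -> v != 0 ->
    f K u v * (u * v) ^+ M = (map_poly (map_poly intr) P).[u, v].

Section Laurent.
Implicit Types f g : forall K : fieldType, K -> K -> K.

Lemma laurent_ext f g : (forall K u v, f K u v = g K u v) -> laurent f -> laurent g.
Proof. by move=> fg [M [P fP]]; exists M, P => K u v u0 v0; rewrite -fg fP. Qed.

Lemma laurent_int (m : int) : laurent (fun K _ _ => m%:~R).
Proof.
exists 0%N, m%:P%:P => K u v _ _.
by rewrite expr0 mulr1 !map_polyC /= map_polyC /= !hornerC.
Qed.

Lemma laurentD f g : laurent f -> laurent g ->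
  laurent (fun K u v => f K u v + g K u v).
Proof.
move=> [M [P fP]] [M' [Q gQ]].
exists (M + M')%N, (P * ('X * 'Y) ^+ M' + Q * ('X * 'Y) ^+ M) => K u v u0 v0.
rewrite !rmorphD !rmorphM !rmorphXn /= !rmorphM /= map_polyX map_polyC /= map_polyX.
by rewrite !hornerE -fP // -gQ // exprD; ring.
Qed.

Lemma laurentM f g : laurent f -> laurent g ->
  laurent (fun K u v => f K u v * g K u v).
Proof.
move=> [M [P fP]] [M' [Q gQ]]; exists (M + M')%N, (P * Q) => K u v u0 v0.
by rewrite !rmorphM !hornerM -fP // -gQ // exprD; ring.
Qed.

Lemma laurentX f n : laurent f -> laurent (fun K u v => f K u v ^+ n).
Proof.
move=> lf; elim: n => [|n IHn]; first exact: (laurent_int 1).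
by apply: laurent_ext (laurentM lf IHn) => K u v; rewrite exprS.
Qed.

Lemma laurent_u : laurent (fun K u _ => u).
Proof.
by exists 0%N, 'X => K u v _ _; rewrite map_polyX !hornerE.
Qed.

Lemma laurent_v : laurent (fun K _ v => v).
Proof.
by exists 0%N, 'Y => K u v _ _; rewrite map_polyC /= map_polyX !hornerE.
Qed.

Lemma laurent_uV : laurent (fun K u _ => u^-1).
Proof.
exists 1%N, 'Y => K u v u0 v0.
by rewrite map_polyC /= map_polyX hornerC hornerX expr1 mulKf.
Qed.

Lemma laurent_vV : laurent (fun K _ v => v^-1).
Proof.
exists 1%N, 'X => K u v u0 v0.
by rewrite map_polyX hornerX hornerC expr1 mulrC mulfK.
Qed.

Lemma laurent_horner2 (P : {poly {poly int}}) f g : laurent f -> laurent g ->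
  laurent (fun K u v => (map_poly (map_poly intr) P).[f K u v, g K u v]).
Proof.
move=> lf lg; elim/poly_ind: P => [|P c IHP].
  by apply: laurent_ext (laurent_int 0) => K u v; rewrite map_poly0 !hornerE.
have lc : laurent (fun K u v => (map_poly intr c).[g K u v]).
  elim/poly_ind: c => [|c d IHc].
    by apply: laurent_ext (laurent_int 0) => K u v; rewrite map_poly0 !hornerE.
  apply: laurent_ext (laurentD (laurentM IHc lg) (laurent_int d)) => K u v.
  by rewrite rmorphD rmorphM /= map_polyX map_polyC /= !hornerE.
apply: laurent_ext (laurentD (laurentM IHP lf) lc) => K u v.
by rewrite rmorphD rmorphM /= map_polyX map_polyC /= !hornerE.
Qed.

Lemma laurent_torus_phi k :
  laurent (fun K u v => (torus_phi (u ^+ k, v ^+ k)).1) /\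
  laurent (fun K u v => (torus_phi (u ^+ k, v ^+ k)).2).
Proof.
pose E := (laurentX k laurent_u, laurentX k laurent_v,
  laurentX k laurent_uV, laurentX k laurent_vV).
pose lu := E.1.1.1; pose lv := E.1.1.2; pose lu' := E.1.2; pose lv' := E.2.
split.
  apply: laurent_ext (laurentD (laurentD (laurentD (laurentD (laurentD lu lv)
    (laurentM lu lv)) lu') lv') (laurentM lu' lv')) => K u v.
  by rewrite /torus_phi /= !exprVn invfM.
apply: laurent_ext (laurentD (laurentD (laurentD (laurentD (laurentD
  (laurentM (laurentX 2 lu) lv) (laurentM lu (laurentX 2 lv))) (laurentM lu lv'))
  (laurentM (laurentX 2 lu') lv')) (laurentM lu' (laurentX 2 lv')))
  (laurentM lv lu')) => K u v.
by rewrite /torus_phi /= !invfM -!exprVn.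
Qed.

End Laurent.

Lemma poly_nat_roots (D : idomainType) (p : {poly D}) :
  [pchar D] =i pred0 -> (forall m : nat, (0 < m)%N -> p.[m%:R] = 0) -> p = 0.
Proof.
move=> ch0 pm; apply/eqP; apply/negPn/negP => p0.
pose rs : seq D := [seq m%:R | m <- iota 1 (size p)].
have := @max_poly_roots D p rs p0; rewrite size_map size_iota ltnn.
have /pcharf0P ch := ch0.
have inj : injective (fun m : nat => m%:R : D).
  move=> m1 m2 /=; wlog le12 : m1 m2 / (m1 <= m2)%N => [H e|].
    by case/orP: (leq_total m1 m2) => le; [apply: H|symmetry; apply: H].
  move/eqP; rewrite eq_sym -subr_eq0 -natrB // ch subn_eq0 => le21.
  by apply/eqP; rewrite eqn_leq le12.
rewrite map_inj_uniq ?iota_uniq // => H; suff : false by [].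
apply: H => //; apply/allP => _ /mapP [m mi ->].
by rewrite rootE pm //; rewrite mem_iota in mi; case/andP: mi.
Qed.

Lemma laurent_eq0 (K0 : numFieldType) f : laurent f ->
  (forall m n : nat, (0 < m)%N -> (0 < n)%N -> f K0 m%:R n%:R = 0) ->
  forall (K : fieldType) (u v : K), u != 0 -> v != 0 -> f K u v = 0.
Proof.
move=> [M [P fP]] f0 K u v u0 v0.
suff P0 : P = 0.
  move: (fP K u v u0 v0); rewrite P0 map_poly0 !hornerE => /eqP.
  by rewrite mulf_eq0 expf_eq0 !mulf_eq0 (negPf u0) (negPf v0) !andbF !orbF => /eqP.
apply: poly_nat_roots => [|m m0].
  by move=> p; rewrite pchar_poly pchar_num.
apply: poly_nat_roots => [|n n0]; first exact: pchar_num.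
have := fP K0 m%:R n%:R; rewrite f0 // mul0r !pnatr_eq0 -!lt0n => /(_ m0 n0).
pose f1 : {rmorphism int -> K0} := intr.
pose f2 : {rmorphism {poly int} -> {poly K0}} := map_poly f1.
have -> : (m%:R : K0)%:P = f2 m%:R by rewrite !rmorph_nat.
have -> : (n%:R : K0) = f1 n%:R by rewrite rmorph_nat.
rewrite (horner_map f2) (horner_map f1) => /esym/eqP.
by rewrite intr_eq0 => /eqP.
Qed.

Lemma polymap_rmorph (K L : fieldType) (f : {rmorphism K -> L}) G x :
  polymap G (f x.1, f x.2) = (f (polymap G x).1, f (polymap G x).2).
Proof.
have E (P : {poly {poly int}}) : (map_poly (map_poly intr) P).[f x.1, f x.2]
    = f (map_poly (map_poly intr) P).[x.1, x.2].
  pose F : {rmorphism {poly K} -> {poly L}} := map_poly f.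
  have -> : (f x.1)%:P = F x.1%:P by rewrite /= map_polyC.
  rewrite -horner_map -(horner_map F) -map_poly_comp; congr _.[_].[_].
  apply: eq_map_poly => c /=; rewrite -map_poly_comp; apply: eq_map_poly => m /=.
  by rewrite rmorph_int.
by rewrite /polymap !E.
Qed.

Lemma polymap_torus (R : realType) (k : nat) G (K : fieldType) (u v : K) :
  is_G2_folding R k G -> u != 0 -> v != 0 ->
  polymap G (torus_phi (u, v)) = torus_phi (u ^+ k, v ^+ k).
Proof.
move=> folG u0 v0; have [l1 l2] := laurent_torus_phi 1; have [k1 k2] := laurent_torus_phi k.
have E (P : {poly {poly int}}) (f : forall K : fieldType, K -> K -> K) : laurent f ->
  (forall s t : R[i], (map_poly (map_poly intr) P).[phi1 s t, phi2 s t]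
      = f _ (e2pii s) (e2pii t)) ->
  (map_poly (map_poly intr) P).[(torus_phi (u, v)).1, (torus_phi (u, v)).2] = f K u v.
  move=> lf Pf; apply/eqP; rewrite -subr_eq0; apply/eqP.
  pose h (K : fieldType) (u v : K) :=
    (map_poly (map_poly intr) P).[(torus_phi (u ^+ 1, v ^+ 1)).1,
      (torus_phi (u ^+ 1, v ^+ 1)).2] + (-1)%:~R * f K u v.
  have -> : (map_poly (map_poly intr) P).[(torus_phi (u, v)).1, (torus_phi (u, v)).2]
    - f K u v = h K u v by rewrite /h !expr1 mulN1r.
  apply: (@laurent_eq0 (R[i] : numFieldType)) u0 v0.
    exact: laurentD (laurent_horner2 P l1 l2) (laurentM (laurent_int _) lf).
  move=> m n m0 n0; have [s Es] := e2pii_natr R m0; have [t Et] := e2pii_natr R n0.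
  have := Phi_torus s t; rewrite /Phi /h -Es -Et !expr1 => <- /=.
  by rewrite Pf mulN1r subrr.
have EPhi s t : polymap G (Phi s t) = torus_phi (e2pii s ^+ k, e2pii t ^+ k) :> R[i] * R[i].
  by rewrite folG Phi_torus !e2piiMn.
rewrite [RHS]surjective_pairing; congr pair.
  by apply: E k1 _ => s t; rewrite -EPhi.
by apply: E k2 _ => s t; rewrite -EPhi.
Qed.

(** * The torus modulo the Weyl group *)

(* The orbit of x = (u, v) under the Weyl group of G_2, with multiplicities:
   setting z = (u v)^-1, its 12 elements permute u, v, z and possibly invert
   them all. *)
Definition orbit_of (T : Type) (mul : T -> T -> T) (inv : T -> T) (x : T * T) :
    seq (T * T) :=
  let half i j l := [:: (i, j); (j, i); (i, l); (l, j); (j, l); (l, i)] in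
  let z := inv (mul x.1 x.2) in
  half x.1 x.2 z ++ half (inv x.1) (inv x.2) (inv z).

Lemma orbit_of_morph (T T' : Type) mul inv mul' inv' (f : T -> T') (x : T * T) :
  {morph f : a b / mul a b >-> mul' a b} -> {morph f : a / inv a >-> inv' a} ->
  orbit_of mul' inv' (f x.1, f x.2)
    = [seq (f y.1, f y.2) | y <- orbit_of mul inv x].
Proof. by move=> fM fV; rewrite /orbit_of /= !fV fM. Qed.

Notation torus_orbit := (orbit_of *%R GRing.inv).

Section TorusOrbits.
Variable K : fieldType.
Implicit Types u v z x y : K.

(* phi_1 and phi_2 + 3 are the sum and the product of the elementary symmetric
   functions e1 and e2 of u, v, z; hence they determine {e1, e2}, and then
   {u, v, z} up to inversion. *)
Lemma torus_phi_e (x : K * K) (e1 := x.1 + x.2 + (x.1 * x.2)^-1)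
    (e2 := x.1^-1 + x.2^-1 + x.1 * x.2) : x.1 != 0 -> x.2 != 0 ->
  torus_phi x = (e1 + e2, e1 * e2 - 3).
Proof.
case: x @e1 @e2 => u v /= u0 v0; congr pair; first by ring.
by field; rewrite u0 v0.
Qed.

Lemma torus_phi_orbit (x y : K * K) : x.1 != 0 -> x.2 != 0 ->
  y \in torus_orbit x -> torus_phi y = torus_phi x.
Proof.
case: x => u v /= u0 v0 yx.
have [z0 uV0 vV0 zV0] : [/\ (u * v)^-1 != 0, u^-1 != 0, v^-1 != 0 & (u * v)^-1^-1 != 0].
  by rewrite !invr_eq0 mulf_neq0.
suff /allP/(_ _ yx)/eqP :
  all (fun y : K * K => torus_phi y == torus_phi (u, v)) (torus_orbit (u, v)) by [].
rewrite /orbit_of /= !torus_phi_e //=.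
rewrite !xpair_eqE; repeat (apply/andP; split=> //); apply/eqP; field;
  by rewrite ?u0 ?v0 ?oner_eq0.
Qed.

Lemma sum_prod_eq2 (a b c d : K) : a + b = c + d -> a * b = c * d ->
  a = c /\ b = d \/ a = d /\ b = c.
Proof.
move=> s p; have : (a - c) * (a - d) = 0.
  have -> : (a - c) * (a - d) = a * a - (c + d) * a + c * d by ring.
  by rewrite -s -p; ring.
move/eqP; rewrite mulf_eq0 !subr_eq0 => /orP[] /eqP ad; [left|right]; split=> //;
  by apply: (addrI a); rewrite s ad // addrC.
Qed.

Lemma torus_phi_inj (x y : K * K) : x.1 != 0 -> x.2 != 0 -> y.1 != 0 -> y.2 != 0 ->
  torus_phi y = torus_phi x -> y \in torus_orbit x.
Proof.
case: x y => [u v] [u' v'] /= u0 v0 u'0 v'0.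
rewrite !torus_phi_e //= => -[es /addIr ep].
have key (a b : K) : a != 0 -> b != 0 ->
    u' + v' + (u' * v')^-1 = a + b + (a * b)^-1 ->
    u'^-1 + v'^-1 + u' * v' = a^-1 + b^-1 + a * b ->
    (u', v') \in [:: (a, b); (b, a); (a, (a * b)^-1); ((a * b)^-1, b);
                     (b, (a * b)^-1); ((a * b)^-1, a)].
  move=> a0 b0 E1 E2; set c := (a * b)^-1; set z' := (u' * v')^-1.
  have c0 : c != 0 by rewrite invr_eq0 mulf_neq0.
  have abc : a * b * c = 1 by rewrite mulfV // mulf_neq0.
  have uvz : u' * v' * z' = 1 by rewrite mulfV // mulf_neq0.
  have E1' : u' + v' + z' = a + b + c by [].
  have E2' : u' * v' + (u' + v') * z' = a * b + (a + b) * c.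
    have -> : (a + b) * c = a^-1 + b^-1 by rewrite /c; field; rewrite a0 b0.
    have -> : (u' + v') * z' = u'^-1 + v'^-1 by rewrite /z'; field; rewrite u'0 v'0.
    by rewrite ![_ * _ + _]addrC.
  have : (u' - a) * (u' - b) * (u' - c) = 0.
    have -> : (u' - a) * (u' - b) * (u' - c) =
      u' ^+ 3 - (a + b + c) * u' ^+ 2 + (a * b + (a + b) * c) * u' - a * b * c by ring.
    by rewrite -E1' -E2' abc -uvz; ring.
  have vz (d e : K) : v' + z' = d + e -> v' * z' = d * e -> v' = d \/ v' = e.
    by move=> H1 H2; have [[]|[]] := sum_prod_eq2 H1 H2; [left|right].
  move/eqP; rewrite !mulf_eq0 !subr_eq0 -orbA !inE !xpair_eqE.
  have S (d e f : K) : u' = d -> d + e + f = a + b + c -> d * e * f = 1 -> v' = e \/ v' = f.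
    move=> Ed E3 E4; apply: vz.
      by apply: (addrI u'); rewrite addrA E1' Ed addrA.
    by apply: (mulfI u'0); rewrite mulrA uvz Ed mulrA.
  case/or3P => /eqP Eu.
  - by have [] := S a b c Eu erefl abc => Ev; rewrite Eu Ev !eqxx ?orbT.
  - have [Ev|Ev] : v' = a \/ v' = c.
    + by apply: (S b) => //; rewrite ?[b + a]addrC ?[b * a]mulrC.
    + by rewrite Eu Ev !eqxx ?orbT.
    + by rewrite Eu Ev !eqxx ?orbT.
  - have [Ev|Ev] : v' = a \/ v' = b.
    + by apply: (S c) => //; rewrite -?abc; ring.
    + by rewrite Eu Ev !eqxx ?orbT.
    + by rewrite Eu Ev !eqxx ?orbT.
have [[E1 E2]|[E1 E2]] := sum_prod_eq2 es ep.
  by have := key u v u0 v0 E1 E2; rewrite /orbit_of mem_cat => ->.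
have := key u^-1 v^-1; rewrite !invr_eq0 !invrK -invfM invrK => /(_ u0 v0 E1 E2).
by rewrite /orbit_of mem_cat /= invrK orbC => ->.
Qed.

End TorusOrbits.

Lemma torus_phi_surj (K : closedFieldType) (y : K * K) :
  exists x : K * K, [/\ x.1 != 0, x.2 != 0 & torus_phi x = y].
Proof.
have root3 (a b c : K) : exists r, r ^+ 3 + a * r ^+ 2 + b * r + c = 0.
  have [r Er] := @solve_monicpoly K 3 (fun n => [:: - c; - b; - a]`_n) isT.
  by exists r; rewrite Er !big_ord_recr big_ord0 /=; ring.
have root2 (b c : K) : exists r, r ^+ 2 + b * r + c = 0.
  have [r Er] := @solve_monicpoly K 2 (fun n => [:: - c; - b]`_n) isT.
  by exists r; rewrite Er !big_ord_recr big_ord0 /=; ring.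
have [e1 E1] := root2 (- y.1) (y.2 + 3).
have [u Eu] := root3 (- e1) (y.1 - e1) (-1).
have u0 : u != 0.
  by apply/eqP => u0; move/eqP: Eu; rewrite u0 !expr0n /= !mulr0 !add0r oppr_eq0 oner_eq0.
have [v Ev] := root2 (u - e1) u^-1.
have v0 : v != 0.
  apply/eqP => v0; move/eqP: Ev; rewrite v0 expr0n /= mulr0 !add0r invr_eq0.
  by rewrite (negPf u0).
exists (u, v); split=> //; rewrite torus_phi_e //=.
have z : (u * v)^-1 = e1 - u - v.
  apply: (mulIf v0); rewrite invfM mulfVK //; apply/eqP; rewrite -subr_eq0 -Ev.
  by apply/eqP; ring.
have vV : v^-1 = u * (e1 - u - v) by rewrite -z invfM mulrA mulfV // mul1r.
have uV : u^-1 = u ^+ 2 - e1 * u + (y.1 - e1).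
  apply: (mulIf u0); rewrite mulVf //; apply/eqP; rewrite -subr_eq0 -oppr_eq0 -Eu.
  by apply/eqP; ring.
rewrite z vV uV [RHS]surjective_pairing; congr pair; first by ring.
by apply/eqP; rewrite -subr_eq0 -oppr_eq0 -E1; apply/eqP; ring.
Qed.

(** * Stabilizers in the Weyl group *)

Notation add_orbit := (orbit_of +%R -%R).

Section Orbits.
Variable V : comNzRingType.
Implicit Types (i j l Q : V) (s t : V * V).

Lemma add_orbit_perm s t : t \in add_orbit s -> perm_eq (add_orbit t) (add_orbit s).
Proof.
case: s => i j; rewrite !inE /= => ts.
have e1 : i - (i + j) = - j by ring.
have e2 : j - (i + j) = - i by ring.
have e3 : - (i + j) + i = - j by ring.
have e4 : - (i + j) + j = - i by ring.
have e5 : - i - j = - (i + j) by ring.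
have e6 : - j - i = - (i + j) by ring.
have e7 : - i + (i + j) = j by ring.
have e8 : - j + (i + j) = i by ring.
have e9 : i + j - i = j by ring.
have e10 : i + j - j = i by ring.
have e11 : j + i = i + j by ring.
apply/permP => P; move: ts; do 11?[case/orP=> [/eqP->|]]; last move/eqP->.
all: rewrite /orbit_of /= ?opprK ?(e1, e2, e3, e4, e5, e6, e7, e8, e9, e10, e11) ?opprK.
all: ring.
Qed.

Local Ltac solve_pair := apply/eqP/eqP => -[<- <-]; congr (_, _); ring.

Lemma count_add_orbitC s t : count_mem t (add_orbit s) = count_mem s (add_orbit t).
Proof.
case: s t => i j [i' j'] /=.
have E (a b c d : V) : ((a, b) == (i', j')) = ((c, d) == (i, j)) ->
  nat_of_bool ((a, b) == (i', j')) = ((c, d) == (i, j)) by move->.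
rewrite (E i j i' j'); last by rewrite eq_sym.
rewrite (E j i j' i'); last by solve_pair.
rewrite (E i _ i' (- (i' + j'))); last by solve_pair.
rewrite (E _ j (- (i' + j')) j'); last by solve_pair.
rewrite (E j _ (- (i' + j')) i'); last by solve_pair.
rewrite (E _ i j' (- (i' + j'))); last by solve_pair.
rewrite (E (- i) (- j) (- i') (- j')); last by solve_pair.
rewrite (E (- j) (- i) (- j') (- i')); last by solve_pair.
rewrite (E (- i) _ (- i') (- (- (i' + j')))); last by solve_pair.
rewrite (E _ (- j) (- (- (i' + j'))) (- j')); last by solve_pair.
rewrite (E (- j) _ (- (- (i' + j'))) (- i')); last by solve_pair.
rewrite (E _ (- i) (- j') (- (- (i' + j')))); last by solve_pair.
ring.
Qed.

Definition fixed_by_reflection s :=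
  let: (i, j) := s in
  [|| i == j, j == - (i + j), i == - (i + j), i == 0, j == 0 | - (i + j) == 0].

Lemma scale_orbit_reflection Q s (t := (Q * s.1, Q * s.2)) :
  fixed_by_reflection s -> t \in add_orbit s -> t = s \/ t = (- s.1, - s.2).
Proof.
have base i j :  (i == j) || (i + j == 0) -> (Q * i, Q * j) \in add_orbit (i, j) ->
    (Q * i, Q * j) = (i, j) \/ (Q * i, Q * j) = (- i, - j).
  { case/orP => [/eqP <-|/eqP ij].
  { have ii (x y : V) : x = y -> (Q * i, Q * i) = (x, y) ->
      x = i \/ x = - i \/ y = i \/ y = - i ->
      (Q * i, Q * i) = (i, i) \/ (Q * i, Q * i) = (- i, - i).
      by move=> <- -> [->|[->|[->|->]]]; auto.
    rewrite !inE /=; do 11?[case/orP=> [/eqP|]]; last move/eqP.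
    all: move=> ts; apply: (ii _ _ _ ts); first by case: ts => Ea Eb; apply: etrans (esym Ea) Eb.
    all: by auto. }
  have -> : j = - i by apply/eqP; rewrite -addr_eq0 addrC ij.
  have ii (x y : V) : y = - x -> (Q * i, Q * - i) = (x, y) ->
    x = i \/ x = - i \/ y = i \/ y = - i ->
    (Q * i, Q * - i) = (i, - i) \/ (Q * i, Q * - i) = (- i, - - i).
    move=> -> ->; rewrite opprK => -[->|[->|[Ey|Ey]]]; rewrite ?opprK; auto.
    - by right; rewrite Ey -[x]opprK Ey.
    - by left; rewrite Ey -[x]opprK Ey opprK.
  rewrite !inE /=; do 11?[case/orP=> [/eqP|]]; last move/eqP.
  all: move=> ts; apply: (ii _ _ _ ts); first by case: ts => Ea Eb;
    apply: etrans (esym Eb) (etrans (mulrN _ _) (congr1 _ Ea)).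
  all: by rewrite ?opprK; auto. }
have rot i j : (Q * i, Q * j) \in add_orbit (i, j) ->
    (Q * j, Q * - (i + j)) \in add_orbit (j, - (i + j)).
  have r i' j' : (j', - (i' + j')) \in add_orbit (i', j') by rewrite !inE eqxx ?orbT.
  move=> /add_orbit_perm/perm_mem Ets; rewrite (perm_mem (add_orbit_perm (r i j))) -Ets.
  by rewrite mulrN mulrDr r.
have unrot i j : (Q * j, Q * - (i + j)) = (j, - (i + j)) \/
    (Q * j, Q * - (i + j)) = (- j, - - (i + j)) ->
    (Q * i, Q * j) = (i, j) \/ (Q * i, Q * j) = (- i, - j).
  have E : Q * i = - (Q * - (i + j)) - Q * j by ring.
  by case=> -[Ej El]; [left|right]; rewrite E El Ej; congr (_, _); ring.
case: s @t => i j /=; rewrite oppr_eq0 => H ts; have ts1 := rot _ _ ts; have ts2 := rot _ _ ts1.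
have il : - (j - (i + j)) = i by ring.
rewrite il in ts2.
have U2 : (Q * - (i + j), Q * i) = (- (i + j), i) \/
    (Q * - (i + j), Q * i) = (- - (i + j), - i) ->
    (Q * i, Q * j) = (i, j) \/ (Q * i, Q * j) = (- i, - j).
  by move=> h; apply/unrot/unrot; rewrite il.
have z1 : (j - (i + j) == 0) = (i == 0) by rewrite -oppr_eq0 il.
have z2 : (- (i + j) + i == 0) = (j == 0).
  by rewrite -oppr_eq0; congr (_ == _); ring.
case: (boolP ((i == j) || (i + j == 0))) => [c|c0]; first exact: base c ts.
case: (boolP ((j == - (i + j)) || (i == 0))) => [c|c1].
  by apply: unrot; apply: base ts1; rewrite z1.
apply: U2; apply: base ts2; rewrite z2 [_ == i]eq_sym.
by move: H c0 c1; do 6?[case: (_ == _)].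
Qed.

(* Counts the w with w s = t in half of the Weyl group: A is the weight of
   w = 1, B that of the three reflections, C that of the two rotations of order
   3. The other half consists of the - w and is reached by negating t. *)
Definition half_count (A B C : bool) s t : nat :=
  let: (i, j) := s in let l := - (i + j) in
  ((A && (t == (i, j))) + (B && (t == (j, i))) + (B && (t == (i, l)))
   + (B && (t == (l, j))) + (C && (t == (j, l))) + (C && (t == (l, i))))%N.

Definition weyl_count (A A' B C C' : bool) s t : nat :=
  (half_count A B C s t + half_count A' B C' s (- t.1, - t.2))%N.

Lemma pair_oppE (t : V * V) (x y : V) : ((- t.1, - t.2) == (x, y)) = (t == (- x, - y)).
Proof. by case: t => a b; rewrite !xpair_eqE /= !eqr_oppLR. Qed.

Lemma weyl_count_true s t : weyl_count true true true true true s t = count_mem t (add_orbit s).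
Proof.
case: s => i j; rewrite /weyl_count /half_count !pair_oppE /orbit_of /= ![_ == t]eq_sym.
ring.
Qed.

Lemma weyl_count_opp A A' B C C' s t :
  weyl_count A A' B C C' s (- t.1, - t.2) = weyl_count A' A B C' C s t.
Proof. by rewrite /weyl_count /= !opprK -surjective_pairing addnC. Qed.

Lemma weyl_count_le A A' B C C' s t :
  (weyl_count A A' B C C' s t <= weyl_count true true true true true s t)%N.
Proof.
by case: s => i j; rewrite /weyl_count /half_count; do !apply: leq_add; case: (_ == _);
  rewrite ?andbT ?andbF ?leq_b1.
Qed.

Definition nb_fixing_reflections s : nat :=
  let: (i, j) := s in let l := - (i + j) in
  ((i == j) + (j == l) + (i == l) + (i == 0%R) + (j == 0%R) + (l == 0%R))%N.

End Orbits.

Section FixedPoints.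
Variable V : comNzRingType.
Implicit Types (i j l Q : V) (s t : V * V).

Lemma weyl_count_diag A A' B C C' i j (l := - (i + j)) (d := (i + i == 0) && (j + j == 0))
    (s0 := (i == 0) && (j == 0)) :
  weyl_count A A' B C C' (i, j) (i, j) =
  (A + B * nb_fixing_reflections (i, j) + 2 * (C * ((i == j) && (j == l)))
  + A' * d + 2 * (C' * s0))%N.
Proof.
have e1 : (i == l) && (j == j) = (i == l) by rewrite eqxx andbT.
have e2 : ((i, j) == (j, i)) = (i == j) by rewrite xpair_eqE [j == i]eq_sym andbb.
have e3 : ((i, j) == (j, l)) = (i == j) && (j == l) by [].
have e4 : ((i, j) == (l, i)) = (i == j) && (j == l).
  by rewrite xpair_eqE andbC [j == i]eq_sym; case: eqP => // ->.
have e5 : ((i, j) == (- i, - j)) = d by rewrite xpair_eqE -!addr_eq0.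
have e6 : ((i, j) == (- j, - i)) = (l == 0).
  by rewrite xpair_eqE -!addr_eq0 [j + i]addrC andbb oppr_eq0.
have jl : (j == - l) = (i == 0).
  by rewrite opprK eq_sym -subr_eq0 addrK.
have il : (i == - l) = (j == 0).
  by rewrite opprK eq_sym -subr_eq0 addrAC subrr add0r.
have e7 : ((i, j) == (- i, - l)) = (i == 0).
  by rewrite xpair_eqE jl andbC; case: eqP => //= ->; rewrite oppr0 eqxx.
have e8 : ((i, j) == (- l, - j)) = (j == 0).
  by rewrite xpair_eqE il; case: eqP => //= ->; rewrite oppr0 eqxx.
have e9 : ((i, j) == (- j, - l)) = s0.
  by rewrite xpair_eqE jl andbC /s0; case: eqP => //= ->; rewrite eq_sym oppr_eq0.
have e10 : ((i, j) == (- l, - i)) = s0.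
  by rewrite xpair_eqE il andbC /s0; case: (j =P 0) => [->|]; rewrite ?andbF // eq_sym oppr_eq0.
rewrite /weyl_count /half_count !pair_oppE -/l e2 e3 e4 e5 e6 e7 e8 e9 e10 !xpair_eqE e1 !eqxx.
rewrite /nb_fixing_reflections -/l; case: A A' B C C' => [] [] [] [] [];
  rewrite /=; ring.
Qed.

(* The case t = s of [pointwise_identity]. A stabilizer is generated by the
   reflections it contains, so a point with none has a trivial one; at the
   points of order 2 (stabilizer of order 4) and at those of order 3 fixed by the
   rotations (stabilizer of order 6) the terms g2 and g3 are needed. *)
Lemma fixed_point_identity (A A' B C C' : bool) (g2 g3 : nat) i j (l := - (i + j))
    (d := (i + i == 0) && (j + j == 0)) (s0 := (i == 0) && (j == 0)) :
  (forall x y : V, x + x = 0 -> y + y = 0 -> [|| x == 0, y == 0 | x == y]) ->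
  (s0 -> [&& A, A', B, C & C']) -> (A ==> B) -> (A' ==> B) ->
  (d -> ~~ s0 -> g2 = B * (~~ A + ~~ A'))%N ->
  (i == j -> j == l -> ~~ s0 -> (A = B) /\ (C ==> B) /\ (g3 = 2 * (B && ~~ C))%N) ->
  let X := weyl_count A A' B C C' (i, j) (i, j) in
  ((0 < X)%N * weyl_count true true true true true (i, j) (i, j) + g2 * (d && ~~ s0) =
   X + nb_fixing_reflections (i, j) * B * (~~ A + (d && ~~ A'))
   + g3 * [&& i == j, j == l & ~~ s0])%N.
Proof.
move=> two H0 AB A'B H2 H3; rewrite !weyl_count_diag -/d -/l -/s0 /nb_fixing_reflections -/l.
have lz : (l == 0) = (i + j == 0) by rewrite oppr_eq0.
have r1 : s0 -> [&& i == j, j == l, i == l, d & l == 0].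
  by case/andP => /eqP i0 /eqP j0; rewrite /d /l i0 j0 !addr0 oppr0 eqxx.
have r2 : i == j -> (j == l) = (i == l) by move/eqP->.
have r3 : j == l -> (i == j) = (i == l) by move/eqP->.
have r4 : i == 0 -> (j == 0) = (l == 0) by move/eqP=> i0; rewrite lz i0 add0r.
have r5 : j == 0 -> (i == 0) = (l == 0) by move/eqP=> j0; rewrite lz j0 addr0.
have r6 : i == j -> (l == 0) = d.
  by move/eqP => ij; rewrite lz /d ij andbb.
have r7 : j == l -> (i == 0) = d.
  rewrite /d /l -addr_eq0 => /eqP H.
  have -> : i = - (j + j) by apply/eqP; rewrite -addr_eq0 -H; apply/eqP; ring.
  by rewrite oppr_eq0; case: (j + j =P 0) => [->|]; rewrite ?andbF // oppr0 addr0 eqxx.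
have r8 : i == l -> (j == 0) = d.
  rewrite /d /l -addr_eq0 => /eqP H.
  have -> : j = - (i + i) by apply/eqP; rewrite -addr_eq0 -H; apply/eqP; ring.
  by rewrite oppr_eq0; case: (i + i =P 0) => [->|] //=; rewrite oppr0 addr0 eqxx.
have r9 : i == j -> i == 0 -> s0 by move=> /eqP ij /eqP i0; rewrite /s0 -ij i0 eqxx.
have r10 : j == l -> j == 0 -> s0.
  by rewrite /s0 => /eqP jl /eqP j0; move: (r5); rewrite j0 eqxx -jl j0 eqxx => ->.
have r11 : i == l -> i == 0 -> s0.
  by rewrite /s0 => /eqP il /eqP i0; move: (r4); rewrite i0 eqxx -il i0 eqxx => ->.
have r17 : i == j -> j == 0 -> s0 by move=> /eqP ij /eqP j0; rewrite /s0 ij j0 eqxx.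
have r18 : j == l -> l == 0 -> s0 by move=> jl l0; apply: r10 => //; rewrite (eqP jl).
have r19 : i == l -> l == 0 -> s0 by move=> il l0; apply: r11 => //; rewrite (eqP il).
have r12 : d -> [|| i == 0, j == 0 | i == j].
  by case/andP => /eqP ? /eqP ?; apply: two.
have r13 : d -> i == j -> j == l -> s0.
  by move=> dd ij jl; apply: r9 => //; rewrite r7.
have r14 : d -> i == 0 -> j == l.
  by move=> /andP[_ dj] /eqP i0; rewrite /l i0 add0r -addr_eq0.
have r15 : d -> j == 0 -> i == l.
  by move=> /andP[di _] /eqP j0; rewrite /l j0 addr0 -addr_eq0.
have r16 : s0 = (i == 0) && (j == 0) by [].
have {r1 r2 r3 r4 r5 r6 r7 r8 r9 r10 r11 r12 r13 r14 r15 r16 r17 r18 r19} R :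
  [&& (i == j) ==> (j == 0) ==> s0, (j == l) ==> (l == 0) ==> s0,
  (i == l) ==> (l == 0) ==> s0, s0 ==> [&& i == j, j == l, i == l, d & l == 0],
  (i == j) ==> ((j == l) == (i == l)), (j == l) ==> ((i == j) == (i == l)),
  (i == 0) ==> ((j == 0) == (l == 0)), (j == 0) ==> ((i == 0) == (l == 0)),
  (i == j) ==> ((l == 0) == d), (j == l) ==> ((i == 0) == d), (i == l) ==> ((j == 0) == d),
  (i == j) ==> (i == 0) ==> s0, (j == l) ==> (j == 0) ==> s0, (i == l) ==> (i == 0) ==> s0,
  d ==> [|| i == 0, j == 0 | i == j], d ==> (i == j) ==> (j == l) ==> s0,
  d ==> (i == 0) ==> (j == l), d ==> (j == 0) ==> (i == l) & s0 == (i == 0) && (j == 0)].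
  apply/and4P; split; [by apply/implyP => ?; apply/implyP; apply: r17|
    by apply/implyP => ?; apply/implyP; apply: r18|
    by apply/implyP => ?; apply/implyP; apply: r19|].
  apply/and5P; split; [exact/implyP|by apply/implyP => /r2->|by apply/implyP => /r3->|
    by apply/implyP => /r4->|].
  apply/and5P; split; [by apply/implyP => /r5->|by apply/implyP => /r6->|
    by apply/implyP => /r7->|by apply/implyP => /r8->|].
  apply/and5P; split; [by apply/implyP => ?; apply/implyP; apply: r9|
    by apply/implyP => ?; apply/implyP; apply: r10|
    by apply/implyP => ?; apply/implyP; apply: r11|exact/implyP|].
  apply/and4P; split; last by rewrite eqxx.
  - by apply/implyP => ?; apply/implyP => ?; apply/implyP; apply: r13.
  - by apply/implyP => ?; apply/implyP; apply: r14.
  - by apply/implyP => ?; apply/implyP; apply: r15.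
move: s0 d (i == j) (j == l) (i == l) (i == 0) (j == 0) (l == 0) H0 H2 H3 R {lz two}.
move=> [] [] [] [] [] [] [] [] //= H0 H2 H3 _.
all: rewrite ?muln0 ?addn0 ?muln1.
all: try (case/and5P: (H0 isT) => -> -> -> -> ->; by []).
all: try rewrite (H2 isT isT).
all: try (case: (H3 isT isT isT) => EA [CB ->]; move: CB; rewrite EA).
all: clear H0 H2 H3; move: AB A'B; destruct A, A', B, C, C' => //=; lia.
Qed.
End FixedPoints.

Section PointwiseIdentity.
Variable V : comNzRingType.
Implicit Types (i j l Q : V) (s t : V * V).

Lemma eq_opp_pair i j : ((i, j) == (- i, - j)) = (i + i == 0) && (j + j == 0).
Proof. by rewrite xpair_eqE -!addr_eq0. Qed.

Lemma pointwise_identity (A A' B C C' : bool) (g2 g3 : nat) Q i j (t := (Q * i, Q * j))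
    (l := - (i + j)) (d := (i + i == 0) && (j + j == 0)) (s0 := (i == 0) && (j == 0)) :
  (forall x y : V, x + x = 0 -> y + y = 0 -> [|| x == 0, y == 0 | x == y]) ->
  (s0 -> [&& A, A', B, C & C']) -> (A ==> B) -> (A' ==> B) ->
  (d -> ~~ s0 -> t = (i, j) /\ g2 = B * (~~ A + ~~ A'))%N ->
  (i == j -> j == l -> ~~ s0 ->
     [/\ t = (i, j), A = B, C ==> B & g3 = 2 * (B && ~~ C)]%N \/
     [/\ t = (- i, - j), A' = B, C' ==> B & g3 = 2 * (B && ~~ C')]%N) ->
  let X := weyl_count A A' B C C' (i, j) t in
  ((0 < X)%N * count_mem (i, j) (add_orbit (i, j)) + g2 * (d && ~~ s0) =
   X + nb_fixing_reflections (i, j) * B * ((t == (i, j)) && ~~ A + (t == (- i, - j)) && ~~ A')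
   + g3 * [&& i == j, j == l & ~~ s0])%N.
Proof.
move=> two H0 AB A'B H2 H3; rewrite -weyl_count_true /=.
have no3 : i == j -> j == l -> ~~ s0 -> (i, j) <> (- i, - j).
  move=> /eqP ij /eqP jl /negP s0N /eqP; rewrite eq_opp_pair => /andP[/eqP ii _]; apply: s0N.
  move: jl; rewrite /l /s0 -ij ii oppr0 => ->; by rewrite eqxx.
case: (eqVneq t (i, j)) => [ts|tns].
  rewrite ts eq_opp_pair -/d andTb; apply: fixed_point_identity => //.
  - by move=> dd ss; case: (H2 dd ss).
  - move=> ij jl ss; case: (H3 ij jl ss) => -[E ? ? ?]; first by [].
    by case: (no3 ij jl ss); rewrite -E.
case: (eqVneq t (- i, - j)) => [ts|tns'].
  have -> : weyl_count A A' B C C' (i, j) t = weyl_count A' A B C' C (i, j) (i, j).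
    by rewrite ts -[(- i, - j)]/(- (i, j).1, - (i, j).2) weyl_count_opp.
  have dF : d = false.
    by apply: contraNF tns => dd; rewrite ts eq_sym eq_opp_pair.
  move: (@fixed_point_identity V A' A B C' C g2 g3 i j); rewrite -/d dF => -> //.
  - by rewrite ?andFb ?andTb ?addn0 ?add0n.
  - by move=> ss; case/and5P: (H0 ss) => -> -> -> -> ->.
  - move=> ij jl ss; case: (H3 ij jl ss) => -[E ? ? ?]; last by [].
    by rewrite E eqxx in tns.
have -> : d && ~~ s0 = false.
  by apply/negP => /andP[dd ss]; case: (H2 dd ss) => E; rewrite E eqxx in tns.
have -> : [&& i == j, j == l & ~~ s0] = false.
  by apply/negP => /and3P[ij jl ss]; case: (H3 ij jl ss) => -[E]; rewrite E eqxx in tns tns'.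
rewrite !andFb addn0 !muln0 !addn0; case: posnP => [->|X0]; first by rewrite mul0n.
have tO : t \in add_orbit (i, j).
  rewrite -has_pred1 has_count -weyl_count_true.
  exact: leq_trans X0 (weyl_count_le _ _ _ _ _ _ _).
have nf : ~~ fixed_by_reflection (i, j).
  apply/negP => fx; case: (scale_orbit_reflection fx tO) => E.
    by case/eqP: tns.
  by case/eqP: tns'.
have st1 : weyl_count true true true true true (i, j) (i, j) = 1%N.
  have dF : d = false.
    apply/negP => dd; have /andP[/eqP ii /eqP jj] := dd.
    by case/or3P: (two i j ii jj) => E; move: nf; rewrite /fixed_by_reflection E ?orbT.
  rewrite weyl_count_diag -/d -/l dF; move: nf.
  rewrite /fixed_by_reflection -/l /nb_fixing_reflections -/l.
  by do 6![case: (_ == _)].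
have X1 : (weyl_count A A' B C C' (i, j) t <= 1)%N.
  rewrite -st1 [leqRHS]weyl_count_true -(permP (add_orbit_perm tO)) count_add_orbitC.
  by rewrite -weyl_count_true weyl_count_le.
by rewrite st1; apply/eqP; rewrite eqn_leq X0 X1.
Qed.
End PointwiseIdentity.

(** * Counting torsion points *)

Section HalfSums.
Variable V : finComNzRingType.
Implicit Types (x y al be Q : V) (s : V * V).

Definition ann (m : nat) s := (m%:R * s.1 == 0) && (m%:R * s.2 == 0).

Definition nb_ann (m : nat) : nat := #|[set x : V | m%:R * x == 0]|.

Definition on_line al be : bool := (al == 1) || (be == 1).

Lemma ann_line m al be x : on_line al be -> ann m (al * x, be * x) = (m%:R * x == 0).
Proof.
rewrite /ann /= => /orP[]/eqP->; rewrite mul1r mulrCA ?[m%:R * (al * x)]mulrCA.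
  by case: (_ * x =P 0) => [->|] //=; rewrite mulr0 eqxx.
by case: (_ * x =P 0) => [->|]; rewrite ?andbF // mulr0 eqxx.
Qed.

Lemma sum_bool (T : finType) (P : pred T) : (\sum_s P s)%N = #|P|.
Proof.
rewrite -sum1_card [RHS]big_mkcond.
by apply: eq_bigr => s; rewrite unfold_in; case: (P s).
Qed.

Lemma sum_line (P : pred (V * V)) al be : on_line al be ->
  (forall s, P s -> exists x, s = (al * x, be * x)) ->
  (\sum_s P s)%N = #|[set x | P (al * x, be * x)]|.
Proof.
move=> albe Pl; rewrite sum_bool.
rewrite -(card_imset (f := fun x => (al * x, be * x))) => [|x y [ex ey]]; last first.
  by case/orP: albe => /eqP E; move: ex ey; rewrite E !mul1r.
apply: eq_card => s; rewrite unfold_in; apply/idP/imsetP => [Ps|[x]].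
  by have [x Ex] := Pl s Ps; exists x; rewrite // inE -Ex.
by rewrite inE => ? ->.
Qed.

Section Half.
Variables (Q : V) (k A B C : nat).
Hypothesis HA : forall x, A%:R * x = 0 <-> exists2 y, x = k%:R * y & Q * y = y.
Hypothesis HB : forall x, B%:R * x = 0 <-> exists2 y, x = k%:R * y & Q * (Q * y) = y.
Hypothesis HC : forall x, C%:R * x = 0 <->
  exists2 y, x = k%:R * y & Q * (Q * y) = - (y + Q * y).

Let annA x : A%:R * x == 0 -> Q * x = x.
Proof. by move/eqP/HA => [y -> E]; rewrite mulrCA E. Qed.

Let annB x : B%:R * x == 0 -> Q * (Q * x) = x.
Proof. by move/eqP/HB => [y -> E]; rewrite -[in RHS]E; ring. Qed.

Let annC x : C%:R * x == 0 -> Q * (Q * x) = - (x + Q * x).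
Proof.
move/eqP/HC => [y -> E].
have -> : Q * (Q * (k%:R * y)) = k%:R * (Q * (Q * y)) by ring.
by rewrite E; ring.
Qed.

Let neg_sum s := - (s.1 + s.2).

Let Qs s := (Q * s.1, Q * s.2).

Lemma sum_half_count :
  (\sum_s half_count (ann A s) (ann B s) (ann C s) s (Qs s))%N
    = (nb_ann A ^ 2 + 3 * nb_ann B + 2 * nb_ann C)%N.
Proof.
have L1 (m : nat) (w : V * V -> V * V) al be : on_line al be ->
    (forall s, Qs s = w s -> exists x, s = (al * x, be * x)) ->
    (forall x, m%:R * x == 0 -> Qs (al * x, be * x) = w (al * x, be * x)) ->
    (\sum_s (ann m s && (Qs s == w s)))%N = nb_ann m.
  move=> albe H1 H2; rewrite (@sum_line (fun s => ann m s && (Qs s == w s)) al be) //.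
    apply: eq_card => x; rewrite !inE ann_line //.
    by case: (boolP (_ == 0)) => // /H2 ->; rewrite eqxx.
  by move=> s /andP[_ /eqP]; apply: H1.
have SA : (\sum_s (ann A s && (Qs s == s)))%N = (nb_ann A ^ 2)%N.
  rewrite sum_bool -mulnn -cardsX; apply: eq_card => -[x y].
  rewrite unfold_in !inE /ann /=.
  by case: (boolP (_ == 0)) => //= /annA E1; case: (boolP (_ == 0)) => //= /annA E2;
    rewrite /Qs /= E1 E2 eqxx.
have S1 : (\sum_s (ann B s && (Qs s == (s.2, s.1))))%N = nb_ann B.
  apply: (@L1 B (fun s => (s.2, s.1)) 1 Q); rewrite /on_line ?eqxx //.
    by move=> [i j]; rewrite /Qs /neg_sum /= => -[Ei _]; exists i; rewrite mul1r Ei.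
  by move=> x /annB E; rewrite /Qs /neg_sum /= !mul1r E.
have S2 : (\sum_s (ann B s && (Qs s == (s.1, neg_sum s))))%N = nb_ann B.
  apply: (@L1 B (fun s => (s.1, neg_sum s)) (- (Q + 1)) 1); rewrite /on_line ?eqxx ?orbT //.
    move=> [i j]; rewrite /Qs /neg_sum /= => -[_ Ej]; exists j; rewrite mul1r; congr pair.
    by apply/eqP; rewrite -subr_eq0 mulNr mulrDl Ej; apply/eqP; ring.
  move=> x /annB E; rewrite /Qs /neg_sum /= !mul1r; congr pair; last by ring.
  by rewrite !(mulNr, mulrN, mulrDl, mulrDr) mul1r E addrC.
have S3 : (\sum_s (ann B s && (Qs s == (neg_sum s, s.2))))%N = nb_ann B.
  apply: (@L1 B (fun s => (neg_sum s, s.2)) 1 (- (Q + 1))); rewrite /on_line ?eqxx //.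
    move=> [i j]; rewrite /Qs /neg_sum /= => -[Ei _]; exists i; rewrite mul1r; congr pair.
    by apply/eqP; rewrite -subr_eq0 mulNr mulrDl Ei; apply/eqP; ring.
  move=> x /annB E; rewrite /Qs /neg_sum /= !mul1r; congr pair; first by ring.
  by rewrite !(mulNr, mulrN, mulrDl, mulrDr) mul1r E addrC.
have S4 : (\sum_s (ann C s && (Qs s == (s.2, neg_sum s))))%N = nb_ann C.
  apply: (@L1 C (fun s => (s.2, neg_sum s)) 1 Q); rewrite /on_line ?eqxx //.
    by move=> [i j]; rewrite /Qs /neg_sum /= => -[Ei _]; exists i; rewrite mul1r Ei.
  by move=> x /annC E; rewrite /Qs /neg_sum /= !mul1r E.
have S5 : (\sum_s (ann C s && (Qs s == (neg_sum s, s.1))))%N = nb_ann C.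
  apply: (@L1 C (fun s => (neg_sum s, s.1)) Q 1); rewrite /on_line ?eqxx ?orbT //.
    by move=> [i j]; rewrite /Qs /neg_sum /= => -[_ Ej]; exists j; rewrite mul1r Ej.
  by move=> x /annC E; rewrite /Qs /neg_sum /= !mul1r E [x + _]addrC.
transitivity (\sum_s ((ann A s && (Qs s == s)) + (ann B s && (Qs s == (s.2, s.1)))
    + (ann B s && (Qs s == (s.1, neg_sum s))) + (ann B s && (Qs s == (neg_sum s, s.2)))
  + (ann C s && (Qs s == (s.2, neg_sum s))) + (ann C s && (Qs s == (neg_sum s, s.1))))%N).
  by apply: eq_bigr => -[i j] _.
by rewrite !big_split /= SA S1 S2 S3 S4 S5; ring.
Qed.

Let lines (m : nat) (w : V * V -> V * V) (P : V -> Prop) s : Prop :=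
  (ann m s && (Qs s == w s)) <-> exists2 r, s = (k%:R * r.1, k%:R * r.2) & Qs r = w r.

Let linesP m w P al be s : on_line al be ->
  (forall s, Qs s = w s -> exists x, s = (al * x, be * x)) ->
  (forall x, P x -> Qs (al * x, be * x) = w (al * x, be * x)) ->
  (forall r, Qs r = w r -> P r.1 /\ P r.2) ->
  (forall r, w (k%:R * r.1, k%:R * r.2) = (k%:R * (w r).1, k%:R * (w r).2)) ->
  (forall x, m%:R * x = 0 <-> exists2 y, x = k%:R * y & P y) ->
  lines m w P s.
Proof.
move=> albe H1 H2 H3 wk Hm; split=> [/andP[am /eqP E]|[r Er E]].
  have [x Ex] := H1 _ E; move: am.
  rewrite Ex ann_line // => /eqP/Hm[y -> Py]; exists (al * y, be * y); last exact: H2.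
  by congr pair; rewrite /=; ring.
have [P1 P2] := H3 _ E.
have Z1 : m%:R * s.1 = 0 by apply/Hm; exists r.1; rewrite // Er.
have Z2 : m%:R * s.2 = 0 by apply/Hm; exists r.2; rewrite // Er.
rewrite /ann Z1 Z2 eqxx /= Er wk -E /Qs /=; apply/eqP; congr pair; ring.
Qed.

Let lines_id s : lines A id (fun y => Q * y = y) s.
Proof.
split=> [/andP[/andP[/eqP/HA[x Ex Qx] /eqP/HA[y Ey Qy]] _]|[r -> E]].
  by exists (x, y); rewrite -?Ex -?Ey -?surjective_pairing // /Qs /= Qx Qy.
have [E1 E2] : Q * r.1 = r.1 /\ Q * r.2 = r.2 by case: r E => ? ? [].
have Z1 : A%:R * (k%:R * r.1) = 0 by apply/HA; exists r.1.
have Z2 : A%:R * (k%:R * r.2) = 0 by apply/HA; exists r.2.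
by rewrite /ann Z1 Z2 eqxx /= /Qs /= ![Q * (_ * _)]mulrCA E1 E2.
Qed.

Let lines_swap s : lines B (fun s => (s.2, s.1)) (fun y => Q * (Q * y) = y) s.
Proof.
apply: (@linesP _ _ _ 1 Q) => //; first by rewrite /on_line eqxx.
- by move=> [i j]; rewrite /Qs /= => -[Ei _]; exists i; rewrite mul1r Ei.
- by move=> x E; rewrite /Qs /= !mul1r E.
- by move=> [i j]; rewrite /Qs /= => -[<- Ej]; rewrite Ej.
Qed.

Let lines_fst s : lines B (fun s => (s.1, neg_sum s)) (fun y => Q * (Q * y) = y) s.
Proof.
apply: (@linesP _ _ _ (- (Q + 1)) 1) => //; first by rewrite /on_line eqxx orbT.
- move=> [i j]; rewrite /Qs /neg_sum /= => -[_ Ej]; exists j; rewrite mul1r; congr pair.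
  by apply/eqP; rewrite -subr_eq0 mulNr mulrDl Ej; apply/eqP; ring.
- move=> x E; rewrite /Qs /neg_sum /= !mul1r; congr pair; last by ring.
  by rewrite !(mulNr, mulrN, mulrDl, mulrDr) mul1r E addrC.
- move=> [i j]; rewrite /Qs /neg_sum /= => -[Ei Ej]; rewrite Ei Ei Ej; split=> //.
  by rewrite mulrN mulrDr Ei Ej; ring.
- by move=> r; rewrite /neg_sum /=; congr pair; ring.
Qed.

Let lines_snd s : lines B (fun s => (neg_sum s, s.2)) (fun y => Q * (Q * y) = y) s.
Proof.
apply: (@linesP _ _ _ 1 (- (Q + 1))) => //; first by rewrite /on_line eqxx.
- move=> [i j]; rewrite /Qs /neg_sum /= => -[Ei _]; exists i; rewrite mul1r; congr pair.
  by apply/eqP; rewrite -subr_eq0 mulNr mulrDl Ei; apply/eqP; ring.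
- move=> x E; rewrite /Qs /neg_sum /= !mul1r; congr pair; first by ring.
  by rewrite !(mulNr, mulrN, mulrDl, mulrDr) mul1r E addrC.
- move=> [i j]; rewrite /Qs /neg_sum /= => -[Ei Ej]; rewrite Ej Ej Ei; split=> //.
  by rewrite mulrN mulrDr Ei Ej; ring.
- by move=> r; rewrite /neg_sum /=; congr pair; ring.
Qed.

Let lines_rot s : lines C (fun s => (s.2, neg_sum s)) (fun y => Q * (Q * y) = - (y + Q * y)) s.
Proof.
apply: (@linesP _ _ _ 1 Q) => //; first by rewrite /on_line eqxx.
- by move=> [i j]; rewrite /Qs /= => -[Ei _]; exists i; rewrite mul1r Ei.
- by move=> x E; rewrite /Qs /neg_sum /= !mul1r E.
- move=> [i j]; rewrite /Qs /neg_sum /= => -[Ei Ej]; rewrite Ei Ej; split=> //.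
  by rewrite mulrN mulrDr Ei Ej; ring.
- by move=> r; rewrite /neg_sum /=; congr pair; ring.
Qed.

Let lines_tor s : lines C (fun s => (neg_sum s, s.1)) (fun y => Q * (Q * y) = - (y + Q * y)) s.
Proof.
apply: (@linesP _ _ _ Q 1) => //; first by rewrite /on_line eqxx orbT.
- by move=> [i j]; rewrite /Qs /= => -[_ Ej]; exists j; rewrite mul1r Ej.
- by move=> x E; rewrite /Qs /neg_sum /= !mul1r E [x + _]addrC.
- move=> [i j]; rewrite /Qs /neg_sum /= => -[Ei Ej]; rewrite Ej Ei; split; last by ring.
  by rewrite mulrN mulrDr Ei Ej; ring.
- by move=> r; rewrite /neg_sum /=; congr pair; ring.
Qed.

Lemma half_count_gt0 s : (0 < half_count (ann A s) (ann B s) (ann C s) s (Qs s))%N <->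
  exists2 r, s = (k%:R * r.1, k%:R * r.2) &
    Qs r \in [:: (r.1, r.2); (r.2, r.1); (r.1, - (r.1 + r.2)); (- (r.1 + r.2), r.2);
                (r.2, - (r.1 + r.2)); (- (r.1 + r.2), r.1)].
Proof.
have -> : (0 < half_count (ann A s) (ann B s) (ann C s) s (Qs s))%N =
  [|| ann A s && (Qs s == s), ann B s && (Qs s == (s.2, s.1)),
   ann B s && (Qs s == (s.1, neg_sum s)),
   ann B s && (Qs s == (neg_sum s, s.2)), ann C s && (Qs s == (s.2, neg_sum s))
   | ann C s && (Qs s == (neg_sum s, s.1))].
  by case: s => i j; rewrite /half_count; do 6![case: (_ && _)].
split=> [|[r Er]].
  case/or4P=> [/lines_id|/lines_swap|/lines_fst|/or3P[/lines_snd|/lines_rot|/lines_tor]];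
  by case=> r Er E; exists r => //; rewrite E !inE -?surjective_pairing eqxx ?orbT.
rewrite !inE -surjective_pairing => /or4P[/eqP E|/eqP E|/eqP E|/or3P[] /eqP E].
- by have -> : ann A s && (Qs s == s) by apply/lines_id; exists r.
- by have -> : ann B s && (Qs s == (s.2, s.1)); [apply/lines_swap; exists r|rewrite orbT].
- by have -> : ann B s && (Qs s == (s.1, neg_sum s)); [apply/lines_fst; exists r|rewrite !orbT].
- by have -> : ann B s && (Qs s == (neg_sum s, s.2)); [apply/lines_snd; exists r|rewrite !orbT].
- by have -> : ann C s && (Qs s == (s.2, neg_sum s)); [apply/lines_rot; exists r|rewrite !orbT].
- by have -> : ann C s && (Qs s == (neg_sum s, s.1)); [apply/lines_tor; exists r|rewrite !orbT].
Qed.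

End Half.
End HalfSums.

Section ReflectionSum.
Variable V : finComNzRingType.
Implicit Types (x y e Q : V) (s : V * V).

Lemma sum_fixing_reflections Q e (a b : nat)
    (P := fun s => [&& ann b s, (Q * s.1, Q * s.2) == (e * s.1, e * s.2) & ~~ ann a s])
    (n := #|[set x : V | [&& b%:R * x == 0, Q * x == e * x & ~~ (a%:R * x == 0)]]|) :
  (\sum_s nb_fixing_reflections s * P s)%N = (6 * n)%N.
Proof.
have L (cond : pred (V * V)) (al be : V) : on_line al be ->
    (forall i j, cond (i, j) -> exists x, (i, j) = (al * x, be * x)) ->
    (forall x, cond (al * x, be * x)) -> (\sum_s (cond s && P s))%N = n.
  move=> albe H1 H2; rewrite (@sum_line _ (fun s => cond s && P s) al be) //; last first.
    by move=> [i j] /andP[/H1].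
  apply: eq_card => x; rewrite !inE H2 /P !ann_line //=; congr [&& _, _ & _].
  by case/orP: albe => /eqP->; rewrite xpair_eqE !mul1r !(mulrCA Q) !(mulrCA e);
    case: (Q * x =P e * x) => [->|]; rewrite ?andbF ?eqxx.
have l11 be : on_line (1 : V) be by rewrite /on_line eqxx.
have l12 al : on_line al (1 : V) by rewrite /on_line eqxx orbT.
have S1 := L (fun s => s.1 == s.2) 1 1 (l11 _).
have S2 := L (fun s => s.2 == - (s.1 + s.2)) (- 2) 1 (l12 _).
have S3 := L (fun s => s.1 == - (s.1 + s.2)) 1 (- 2) (l11 _).
have S4 := L (fun s => s.1 == 0) 0 1 (l12 _).
have S5 := L (fun s => s.2 == 0) 1 0 (l11 _).
have S6 := L (fun s => - (s.1 + s.2) == 0) 1 (- 1) (l11 _).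
pose l s := - (s.1 + s.2).
transitivity (\sum_s (((s.1 == s.2) && P s) + ((s.2 == l s) && P s)
   + ((s.1 == l s) && P s) + ((s.1 == 0%R) && P s) + ((s.2 == 0%R) && P s)
   + ((l s == 0%R) && P s)))%N.
  apply: eq_bigr => -[i j] _; rewrite /nb_fixing_reflections /=; case: (P _).
    by rewrite !andbT muln1.
  by rewrite !andbF muln0.
rewrite !big_split /= S1 ?S2 ?S3 ?S4 ?S5 ?S6; first by ring.
all: have LB (u v z : V) : z = 0 -> u = v - z -> u = v by move=> -> ->; rewrite subr0.
all: have LD (u v z : V) : z = 0 -> u = v + z -> u = v by move=> -> ->; rewrite addr0.
- by move=> i j /eqP E; exists i; congr pair; [ring|apply: (LB _ _ _ E); rewrite /=; ring].
- by move=> x /=; apply/eqP; ring.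
- by move=> i j /= /eqP->; exists i; rewrite mul1r mul0r.
- by move=> x /=; rewrite mul0r.
- by move=> i j /= /eqP->; exists j; rewrite mul1r mul0r.
- by move=> x /=; rewrite mul0r.
- move=> i j; rewrite -subr_eq0 => /eqP E; exists i.
  by congr pair; [ring|apply: (LD _ _ _ E); rewrite /=; ring].
- by move=> x /=; apply/eqP; ring.
- move=> i j; rewrite -subr_eq0 => /eqP E; exists j.
  by congr pair; [apply: (LD _ _ _ E); rewrite /=; ring|ring].
- by move=> x /=; apply/eqP; ring.
- by move=> i j /eqP /= ->; exists j; rewrite mul1r.
- by move=> x /=.
Qed.
End ReflectionSum.

Section IntegersModN.
Variable N : nat.
Hypothesis N_gt1 : (1 < N)%N.
Local Notation V := 'Z_N.
Implicit Types x y : V.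

Lemma natr_Zp_eq0 m : (m%:R == 0 :> V) = (N %| m)%N.
Proof. by rewrite -val_eqE /= val_Zp_nat // /dvdn. Qed.

Lemma Zp_natmul_eq0 m x : (m%:R * x == 0) = (N %| m * x)%N.
Proof. by rewrite -[x in LHS]natr_Zp -natrM natr_Zp_eq0. Qed.

Lemma Zp_ltn x : (x < N)%N.
Proof. by rewrite -{2}(Zp_cast N_gt1) ltn_ord. Qed.

Lemma nb_ann_Zp m : (0 < m)%N -> (m %| N)%N -> nb_ann 'Z_N m = m.
Proof.
move=> m0 /dvdnP[h Nhm]; have h0 : (0 < h)%N by case: h Nhm => // N0; move: N_gt1; rewrite N0.
rewrite /nb_ann -[RHS]card_ord.
have inj : injective (fun y : 'I_m => (h * y)%N%:R : V).
  move=> y z /(congr1 val); rewrite /= !val_Zp_nat // !modn_small ?Nhm ?ltn_pmul2l //.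
  by move/eqP; rewrite eqn_pmul2l // => /eqP/val_inj.
rewrite -(card_imset _ inj); apply: eq_card => x; rewrite inE Zp_natmul_eq0.
apply/idP/imsetP => [|[y _ ->]].
  rewrite [X in (X %| _)%N]Nhm [(h * m)%N]mulnC dvdn_pmul2l // => /dvdnP[w Ew].
  have wm : (w < m)%N by rewrite -(ltn_pmul2r h0) -Ew [(m * h)%N]mulnC -Nhm Zp_ltn.
  by exists (Ordinal wm) => //=; rewrite mulnC -Ew natr_Zp.
rewrite -Zp_natmul_eq0 -natrM natr_Zp_eq0 mulnA [(m * h)%N]mulnC -Nhm.
exact: dvdn_mulr.
Qed.

Lemma reduced_ann m k x : (0 < k)%N -> (m %| N)%N ->
  (m %/ gcdn m k)%:R * x = 0 <-> exists2 y, x = k%:R * y & m%:R * y = 0.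
Proof.
move=> k0 mN; set g := gcdn m k; have [h Nhm] := dvdnP mN.
have [r Em] := dvdnP (dvdn_gcdl m k); have [c Ek] := dvdnP (dvdn_gcdr m k).
rewrite -/g in Em Ek.
have g0 : (0 < g)%N by rewrite gcdn_gt0 k0 orbT.
have N0 : (N%:R : V) = 0 by apply/eqP; rewrite natr_Zp_eq0.
have -> : (m %/ g)%N = r by rewrite Em mulnK.
have r0 : (0 < r)%N by case: r Em => // Em; move: N_gt1; rewrite Nhm Em muln0.
split=> [/eqP|[y -> my]]; last first.
  rewrite mulrA -natrM Ek [(c * g)%N]mulnC mulnA -Em natrM mulrAC my mul0r //.
rewrite Zp_natmul_eq0 [X in (X %| _)%N]Nhm Em mulnCA dvdn_pmul2l // => /dvdnP[w Ew].
case: (egcdnP m k0) => u v uv _; rewrite gcdnC -/g in uv.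
exists (h * w * u)%N%:R; last first.
  have E : (m * (h * w * u) = N * (w * u))%N by rewrite Nhm; ring.
  by rewrite -natrM -Em E natrM N0 mul0r.
have E : (k * (h * w * u) = w * v * N + w * (h * g))%N.
  have -> : (k * (h * w * u) = h * w * (u * k))%N by ring.
  by rewrite uv Nhm; ring.
by rewrite -natrM -[LHS]natr_Zp Ew E natrD [in RHS]natrM N0 mulr0 add0r.
Qed.

Lemma Zp_order2 x y : x + x = 0 -> y + y = 0 -> [|| x == 0, y == 0 | x == y].
Proof.
have E (z : V) : z + z = 0 -> (N %| 2 * z)%N.
  by move=> zz; rewrite -Zp_natmul_eq0 mulr_natl mulr2n zz.
move=> /E /dvdnP[c Ec] /E /dvdnP[d Ed]; rewrite -!val_eqE /=.
have N0 := ltnW N_gt1.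
have c2 : (c < 2)%N by rewrite -(ltn_pmul2r N0) -Ec ltn_pmul2l ?Zp_ltn.
have d2 : (d < 2)%N by rewrite -(ltn_pmul2r N0) -Ed ltn_pmul2l ?Zp_ltn.
by move: c d c2 d2 Ec Ed => [|[|//]] [|[|//]] _ _; clear; lia.
Qed.

End IntegersModN.

Section AnnZp.
Variable N : nat.
Hypothesis N_gt1 : (1 < N)%N.
Local Notation V := 'Z_N.
Implicit Types (x : V) (s : V * V).

Lemma Zp_gcd_eq0 m n x :
  ((gcdn m n)%:R * x == 0) = (m%:R * x == 0) && (n%:R * x == 0).
Proof. by rewrite !Zp_natmul_eq0 // muln_gcdl dvdn_gcd. Qed.

Lemma ann_gcd m n s : ann (gcdn m n) s = ann m s && ann n s.
Proof. by rewrite /ann !Zp_gcd_eq0 andbACA. Qed.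

Lemma ann1 s : ann 1 s = (s == 0).
Proof. by case: s => i j; rewrite /ann /= !mul1r. Qed.

Lemma ann_prime r m s : prime r -> ann r s -> s != 0 -> ann m s = (r %| m)%N.
Proof.
move=> pr rs s0; apply/idP/idP => [ms|/dvdnP[c ->]]; last first.
  by move: rs; rewrite /ann !natrM => /andP[/eqP E1 /eqP E2]; rewrite -!mulrA E1 E2 mulr0 eqxx.
apply: contraNT s0; rewrite -prime_coprime // => /eqP co.
by rewrite -ann1 -co ann_gcd rs ms.
Qed.

Lemma annN s : ann N s.
Proof. by rewrite /ann !Zp_natmul_eq0 // !dvdn_mulr. Qed.

Lemma ann_reduced k m m' s : (0 < k)%N -> (m %| m')%N -> (m' %| N)%N ->
  ann (m %/ gcdn m k) s -> ann (m' %/ gcdn m' k) s.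
Proof.
move=> k0 mm' m'N.
have L x : (m %/ gcdn m k)%:R * x == 0 -> (m' %/ gcdn m' k)%:R * x == 0.
  move/eqP/(reduced_ann N_gt1 _ k0 (dvdn_trans mm' m'N)) => [y Ey my].
  apply/eqP/(reduced_ann N_gt1 _ k0 m'N); exists y => //.
  by have /dvdnP[c ->] := mm'; rewrite natrM -mulrA my mulr0.
by case/andP => /L E1 /L E2; rewrite /ann E1 E2.
Qed.

Lemma card_ann_diff g m : (0 < m)%N -> (m %| g)%N -> (0 < g)%N -> (g %| N)%N ->
  #|[set x : V | (g%:R * x == 0) && (m%:R * x != 0)]| = (g - m)%N.
Proof.
move=> m0 mg g0 gN; have mN := dvdn_trans mg gN.
transitivity (nb_ann V g - nb_ann V m)%N; last by rewrite !nb_ann_Zp.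
rewrite /nb_ann -cardsDS; last first.
  apply/subsetP => x; rewrite !inE; have /dvdnP[c ->] := mg.
  by rewrite natrM -mulrA => /eqP->; rewrite mulr0.
by apply: eq_card => x; rewrite !inE andbC.
Qed.

End AnnZp.

Section Count.
Variables k q : nat.
Hypotheses (k_gt0 : (0 < k)%N) (q_gt1 : (1 < q)%N).
Local Notation N := (q ^ 6 - 1)%N.
Local Notation V := 'Z_N.
Local Notation Q := (q%:R : V).
Local Notation a := (a_ k q).
Local Notation a' := (at_ k q).
Local Notation b := (b_ k q).
Local Notation c := (c_ k q).
Local Notation c' := (ct_ k q).
Implicit Types (x y : V) (s : V * V).

Let q2_le : (q <= q ^ 2)%N. Proof. by rewrite -mulnn leq_pmulr // ltnW. Qed.
Let q2_ge : (1 <= q ^ 2)%N. Proof. by rewrite (leq_trans _ q2_le) // ltnW. Qed.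

Let N_factor : N = ((q - 1) * (q + 1) * ((q ^ 2 + q + 1) * (q ^ 2 - q + 1)))%N.
Proof.
have [t ->] : exists t, q = t.+1 by exists q.-1; rewrite prednK // ltnW.
have -> : (t.+1 - 1 = t)%N by rewrite subn1.
have -> : (t.+1 ^ 2 - t.+1 + 1 = t * t + t + 1)%N.
  have -> : (t.+1 ^ 2 = t.+1 + (t * t + t))%N by ring.
  by rewrite addKn.
have -> : (t.+1 ^ 6 = 1 + t * (t.+1 + 1) * ((t.+1 ^ 2 + t.+1 + 1) * (t * t + t + 1)))%N by ring.
by rewrite addKn.
Qed.

Let qqE : (q ^ 2 - 1 = (q - 1) * (q + 1))%N.
Proof. by rewrite -[1%N](exp1n 2) subn_sqr exp1n. Qed.

Lemma torsion_order_gt1 : (1 < N)%N.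
Proof.
have : (2 ^ 6 <= q ^ 6)%N by rewrite leq_exp2r.
by rewrite (_ : 2 ^ 6 = 64)%N //; lia.
Qed.
Let N_gt1 := torsion_order_gt1.
Hint Resolve N_gt1 : core.

Lemma dvdn_N :
  [/\ q - 1 %| N, q + 1 %| N, q ^ 2 - 1 %| N, q ^ 2 + q + 1 %| N & q ^ 2 - q + 1 %| N]%N.
Proof.
rewrite N_factor qqE; split.
- by rewrite -mulnA dvdn_mulr.
- by rewrite -mulnA dvdn_mull // dvdn_mulr.
- exact: dvdn_mulr.
- by rewrite dvdn_mull // dvdn_mulr.
- by rewrite dvdn_mull // dvdn_mull.
Qed.

Let natq1 : (q - 1)%:R = Q - 1. Proof. by rewrite natrB // ltnW. Qed.
Let natq1' : (q + 1)%:R = Q + 1. Proof. by rewrite natrD. Qed.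
Let natqq : (q ^ 2 - 1)%:R = Q ^+ 2 - 1. Proof. by rewrite natrB // natrX. Qed.
Let natc : (q ^ 2 + q + 1)%:R = Q ^+ 2 + Q + 1. Proof. by rewrite !natrD natrX. Qed.
Let natc' : (q ^ 2 - q + 1)%:R = Q ^+ 2 - Q + 1. Proof. by rewrite natrD natrB // natrX. Qed.

Let hyp (m : nat) (u w : V -> V) : (m %| N)%N -> (forall y, m%:R * y = u y - w y) ->
  forall x, (m %/ gcdn m k)%:R * x = 0 <-> exists2 y, x = k%:R * y & u y = w y.
Proof.
move=> mN muw x; split.
  move/(reduced_ann N_gt1 _ k_gt0 mN) => [y -> my]; exists y => //.
  by apply/eqP; rewrite -subr_eq0 -muw my.
move=> [y -> uw]; apply/(reduced_ann N_gt1 _ k_gt0 mN); exists y => //.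
by rewrite muw uw subrr.
Qed.

Let HA x : a%:R * x = 0 <-> exists2 y, x = k%:R * y & Q * y = y.
Proof. by have [d _ _ _ _] := dvdn_N; apply: (hyp (w := id) d) => y; rewrite natq1; ring. Qed.
Let HA' x : a'%:R * x = 0 <-> exists2 y, x = k%:R * y & - Q * y = y.
Proof.
have [_ d _ _ _] := dvdn_N; split.
  move/(hyp (u := id) (w := fun y => - Q * y) d) => [y|y -> E]; first by rewrite natq1'; ring.
  by exists y.
move=> [y -> E]; apply/(hyp (u := id) (w := fun y => - Q * y) d); last by exists y.
by move=> z; rewrite natq1'; ring.
Qed.
Let HB (e : V) : e = Q \/ e = - Q ->
  forall x, b%:R * x = 0 <-> exists2 y, x = k%:R * y & e * (e * y) = y.
Proof.
move=> He x; have [_ _ d _ _] := dvdn_N; apply: (hyp (w := id) d) => y.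
by rewrite natqq; case: He => ->; ring.
Qed.
Let HC x : c%:R * x = 0 <-> exists2 y, x = k%:R * y & Q * (Q * y) = - (y + Q * y).
Proof.
have [_ _ _ d _] := dvdn_N; apply: (hyp (w := fun y => - (y + Q * y)) d) => y.
by rewrite natc; ring.
Qed.
Let HC' x : c'%:R * x = 0 <-> exists2 y, x = k%:R * y & - Q * (- Q * y) = - (y + - Q * y).
Proof.
have [_ _ _ _ d] := dvdn_N.
apply: (hyp (u := fun y => - Q * (- Q * y)) (w := fun y => - (y + - Q * y)) d) => y.
by rewrite natc'; ring.
Qed.

(* The number of w such that s is the k-th multiple of a point r satisfying
   q r = w r, by [torsion_count_gt0] and its proof. *)
Definition torsion_count s : nat :=
  weyl_count (ann a s) (ann a' s) (ann b s) (ann c s) (ann c' s) s (Q * s.1, Q * s.2).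

Let torsion_countE s : torsion_count s =
  (half_count (ann a s) (ann b s) (ann c s) s (Q * s.1, Q * s.2)%R
   + half_count (ann a' s) (ann b s) (ann c' s) s (- Q * s.1, - Q * s.2)%R)%N.
Proof. by rewrite /torsion_count /weyl_count /= !mulNr. Qed.

Lemma torsion_count_gt0 s : (0 < torsion_count s)%N <->
  exists2 r, s = (k%:R * r.1, k%:R * r.2) & (Q * r.1, Q * r.2) \in add_orbit r.
Proof.
rewrite torsion_countE addn_gt0.
have P1 := half_count_gt0 HA (HB (or_introl erefl)) HC s.
have P2 := half_count_gt0 HA' (HB (or_intror erefl)) HC' s.
have flip (r : V * V) : ((- Q * r.1, - Q * r.2) \in
   [:: (r.1, r.2); (r.2, r.1); (r.1, - (r.1 + r.2)); (- (r.1 + r.2), r.2);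
       (r.2, - (r.1 + r.2)); (- (r.1 + r.2), r.1)]) =
  ((Q * r.1, Q * r.2) \in
   [:: (- r.1, - r.2); (- r.2, - r.1); (- r.1, - - (r.1 + r.2)); (- - (r.1 + r.2), - r.2);
       (- r.2, - - (r.1 + r.2)); (- - (r.1 + r.2), - r.1)]).
  pose t : V * V := (Q * r.1, Q * r.2).
  by rewrite !inE !mulNr -!(pair_oppE t).
split=> [/orP[/P1[r Er]|/P2[r Er]]|[r Er]].
- by move=> H; exists r => //; rewrite mem_cat H.
- by move=> H; exists r => //; rewrite mem_cat -flip H orbT.
- rewrite mem_cat => /orP[H|H]; apply/orP; [left; apply/P1|right; apply/P2]; exists r => //.
  by rewrite flip.
Qed.

Let dvdN m : (m %| N)%N -> (m %/ gcdn m k %| N)%N.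
Proof. by move=> mN; apply: dvdn_trans mN; apply: reduced_dvdl. Qed.

Let a_gt0 : (0 < a)%N. Proof. by rewrite reduced_gt0 // subn_gt0. Qed.
Let a'_gt0 : (0 < a')%N. Proof. by rewrite reduced_gt0 // addn1. Qed.
Let qq_gt0 : (0 < q ^ 2 - 1)%N. Proof. by rewrite subn_gt0 -(exp1n 2) ltn_exp2r. Qed.
Let b_gt0 : (0 < b)%N. Proof. by rewrite reduced_gt0. Qed.
Let c_gt0 : (0 < c)%N. Proof. by rewrite reduced_gt0 // addn1. Qed.
Let c'_gt0 : (0 < c')%N. Proof. by rewrite reduced_gt0 // addn1. Qed.

Lemma sum_torsion_count :
  (\sum_s torsion_count s = a ^ 2 + 3 * b + 2 * c + (a' ^ 2 + 3 * b + 2 * c'))%N.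
Proof.
have [da da' db dc dc'] := dvdn_N.
rewrite (eq_bigr _ (fun s _ => torsion_countE s)) big_split /=.
rewrite (sum_half_count HA (HB (or_introl erefl)) HC).
rewrite (sum_half_count HA' (HB (or_intror erefl)) HC').
by rewrite !nb_ann_Zp ?dvdN.
Qed.

Let sum_fixing (e : V) (m M : nat) : M = (q - 1)%N /\ e = 1 \/ M = (q + 1)%N /\ e = -1 ->
  m = (M %/ gcdn M k)%N ->
  (\sum_(s : V * V) nb_fixing_reflections s
     * [&& ann b s, ((Q * s.1, Q * s.2) == (e * s.1, e * s.2))%R & ~~ ann m s]
   = 6 * (gcdn b M - m))%N.
Proof.
move=> He ->; rewrite sum_fixing_reflections; congr (6 * _)%N.
have M0 : (0 < M)%N by case: He => -[-> _]; rewrite ?subn_gt0 ?addn1.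
have MN : (M %| N)%N by have [? ? _ _ _] := dvdn_N; case: He => -[-> _].
have Mqq : (M %| q ^ 2 - 1)%N.
  by rewrite qqE; case: He => -[-> _]; [rewrite dvdn_mulr|rewrite dvdn_mull].
have gN : (gcdn b M %| N)%N by apply: dvdn_trans MN; apply: dvdn_gcdr.
rewrite -[RHS](@card_ann_diff N N_gt1 _ _ _ _ _ gN) ?reduced_gt0 ?gcdn_gt0 ?M0 ?orbT //; last first.
  by rewrite dvdn_gcd reduced_dvdl andbT; apply: dvd_reduced.
apply: eq_card => x; rewrite !inE Zp_gcd_eq0 // -andbA; congr (_ && (_ && _)).
case: He => -[-> ->]; first by rewrite mul1r natq1 mulrBl mul1r subr_eq0.
by rewrite mulN1r natq1' mulrDl mul1r addr_eq0.
Qed.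

Let ord2 s : bool := [&& s.1 + s.1 == 0, s.2 + s.2 == 0 & s != 0].
Let ord3 s : bool := [&& s.1 == s.2, s.2 == - (s.1 + s.2) & s != 0].

Let card_ord2 : (2 %| N)%N -> (\sum_(s : V * V) ord2 s)%N = 3%N.
Proof.
move=> N2; have E : (\sum_(s : V * V) (ord2 s + (s == 0%R)))%N = 4%N.
  transitivity (\sum_(s : V * V) ann 2 s)%N.
    apply: eq_bigr => s _; rewrite /ord2 /ann !mulr_natl !mulr2n.
    by case: (s =P 0) => [->|]; rewrite ?addr0 ?eqxx //= andbT addn0.
  transitivity (nb_ann V 2 * nb_ann V 2)%N; last by rewrite (nb_ann_Zp N_gt1 (isT : 0 < 2)%N N2).
  rewrite sum_bool -cardsX.
  by apply: eq_card => -[x y]; rewrite !inE.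
move: E; rewrite big_split /= [X in (_ + X)%N]sum_bool -[in X in (_ + X)%N]/(pred1 _) card1.
by rewrite addn1 => -[].
Qed.

Let card_ord3 : (3 %| N)%N -> (\sum_(s : V * V) ord3 s)%N = 2%N.
Proof.
move=> N3; rewrite (@sum_line V ord3 1 1) ?/on_line ?eqxx //; last first.
  by move=> [i j] /and3P[/eqP /= -> _ _]; exists j; rewrite mul1r.
transitivity #|[set x : V | (3%:R * x == 0) && (1%:R * x != 0)]|; last exact: card_ann_diff.
apply: eq_card => x; rewrite !inE /ord3 /= !mul1r eqxx -addr_eq0 /=.
have -> : x + (x + x) = 3%:R * x by ring.
by rewrite -[in RHS](andbb (x == 0)).
Qed.

Let coprime_q r : prime r -> (r %| N)%N -> ~~ (r %| q)%N.
Proof.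
move=> pr rN; apply/negP => /dvdnP[t Et].
have q6 : (r %| q ^ 6)%N by rewrite Et expnMn dvdn_mull // dvdn_exp.
have N1 : (1 <= q ^ 6)%N by rewrite expn_gt0 ltnW.
by move: rN; rewrite dvdn_subr // dvdn1 => /eqP r1; rewrite r1 in pr.
Qed.

Lemma torsion_count_pointwise s :
  ((0 < torsion_count s)%N * count_mem s (add_orbit s) + defect2 k q * ord2 s =
   torsion_count s
   + nb_fixing_reflections s
       * [&& ann b s, ((Q * s.1, Q * s.2) == (1 * s.1, 1 * s.2))%R & ~~ ann a s]
   + nb_fixing_reflections s
       * [&& ann b s, ((Q * s.1, Q * s.2) == (-1 * s.1, -1 * s.2))%R & ~~ ann a' s]
   + defect3 k q * ord3 s)%N.
Proof.
have [dva dva' dvb dvc dvc'] := dvdn_N.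
case: s => i j; rewrite !mul1r !mulN1r.
have s0E : ((i, j) != 0) = ~~ ((i == 0) && (j == 0)) by [].
have Q1 x : (q - 1)%:R * x == 0 -> Q * x = x.
  by rewrite natq1 mulrBl mul1r subr_eq0 => /eqP.
have Q1' x : (q + 1)%:R * x == 0 -> Q * x = - x.
  by rewrite natq1' mulrDl mul1r addr_eq0 => /eqP.
have split (x n g o : nat) (B p p' A A' : bool) :
    (x + n * B * ((p && ~~ A) + (p' && ~~ A')) + g * o
     = x + n * [&& B, p & ~~ A] + n * [&& B, p' & ~~ A'] + g * o)%N.
  by case: B; rewrite /= ?muln0 ?addn0 // muln1 mulnDr !addnA.
have mqq : (q - 1 %| q ^ 2 - 1)%N by rewrite qqE dvdn_mulr.
have mqq' : (q + 1 %| q ^ 2 - 1)%N by rewrite qqE dvdn_mull.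
have P := @pointwise_identity V (ann a (i, j)) (ann a' (i, j)) (ann b (i, j)) (ann c (i, j))
  (ann c' (i, j)) (defect2 k q) (defect3 k q) Q i j.
have -> : ord2 (i, j) = (i + i == 0) && (j + j == 0) && ~~ ((i == 0) && (j == 0)).
  by rewrite /ord2 s0E andbA.
have -> : ord3 (i, j) = [&& i == j, j == - (i + j) & ~~ ((i == 0) && (j == 0))].
  by rewrite /ord3 s0E.
refine (etrans (P _ _ _ _ _ _) (split _ _ _ _ _ _ _ _ _)) => {P split}.
- exact: Zp_order2.
- by case/andP => /eqP-> /eqP->; rewrite /ann !mulr0 eqxx.
- by apply/implyP; apply: ann_reduced.
- by apply/implyP; apply: ann_reduced.
- rewrite -s0E => d s0.
  have s2 : ann 2 (i, j) by move: d; rewrite /ann !mulr_natl !mulr2n.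
  have A2 m := ann_prime N_gt1 m (isT : prime 2) s2 s0.
  have q2 : (2 %| q - 1)%N.
    have : ~~ (2 %| q)%N by apply: coprime_q; rewrite -?A2 ?annN.
    by clear -q_gt1; lia.
  have /andP[/= /Q1 E1 /Q1 E2] : ann (q - 1) (i, j) by rewrite A2.
  by rewrite E1 E2 /defect2 !A2.
rewrite -s0E => ij jl s0.
have s3 : ann 3 (i, j).
  have E : 3%:R * i == 0.
    by move: jl; rewrite -(eqP ij) -addr_eq0 => /eqP<-; apply/eqP; ring.
  by rewrite /ann /= -(eqP ij) E.
have A3 m := ann_prime N_gt1 m (isT : prime 3) s3 s0.
have N3 : (3 %| N)%N by rewrite -A3 annN.
have q3 : (q %% 3 = 1)%N \/ (q %% 3 = 2)%N.
  have : ~~ (3 %| q)%N by apply: coprime_q.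
  by clear; lia.
rewrite !A3; case: q3 => q3.
  left; have [-> -> E3] := three_mod1 k_gt0 q_gt1 q3.
  have /andP[/= /Q1 E1 /Q1 E2] : ann (q - 1) (i, j) by rewrite A3; move: q3; clear; lia.
  by rewrite E1 E2 /defect3 E3.
right; have [-> -> E3] := three_mod2 k_gt0 q_gt1 q3.
have /andP[/= /Q1' E1 /Q1' E2] : ann (q + 1) (i, j) by rewrite A3; move: q3; clear; lia.
by rewrite E1 E2 /defect3 E3.
Qed.

Lemma count_identity :
  (\sum_(s : V * V) (0 < torsion_count s)%N * count_mem s (add_orbit s) + 3 * defect2 k q
   = a ^ 2 + 3 * b + 2 * c + (a' ^ 2 + 3 * b + 2 * c')
     + 6 * (gcdn b (q - 1) - a) + 6 * (gcdn b (q + 1) - a') + 2 * defect3 k q)%N.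
Proof.
have [da da' db _ _] := dvdn_N.
rewrite -sum_torsion_count -(@sum_fixing 1 a (q - 1)); [|by left|by []].
rewrite -(@sum_fixing (-1) a' (q + 1)); [|by right|by []].
have -> : (3 * defect2 k q = \sum_(s : V * V) defect2 k q * ord2 s)%N.
  rewrite -big_distrr /defect2; case: (boolP (2 %| b)%N) => [b2|_]; last by rewrite !mul0n.
  have N2 : (2 %| N)%N by apply: dvdn_trans b2 (dvdN db).
  by rewrite [X in (_ = _ * X)%N](card_ord2 N2) mulnC.
have -> : (2 * defect3 k q = \sum_(s : V * V) defect3 k q * ord3 s)%N.
  rewrite -big_distrr /defect3; case: (boolP (_ && _)) => [/andP[_]|_]; last by rewrite !muln0.
  rewrite Euclid_dvdM // => aa3.
  have N3 : (3 %| N)%N by case/orP: aa3 => /dvdn_trans ->; rewrite ?dvdN.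
  by rewrite [X in (_ = _ * X)%N](card_ord3 N3) mulnC.
rewrite -!big_split /=; apply: eq_bigr => s _; exact: torsion_count_pointwise.
Qed.
End Count.

(** * The value set *)

Lemma sum_count_mem (T : finType) (l : seq T) : (\sum_(x : T) count_mem x l)%N = size l.
Proof.
elim: l => [|y l IHl] /=; first by rewrite big1.
rewrite big_split /= IHl -[in RHS]add1n; congr addn.
by rewrite (sum_bool (fun x => y == x)) -(card1 y); apply: eq_card => x; rewrite !inE eq_sym.
Qed.

Lemma prim_root_closed (K : closedFieldType) (m : nat) :
  m%:R != 0 :> K -> exists z : K, m.-primitive_root z.
Proof.
move=> m0; have mpos : (0 < m)%N by case: m m0 => //; rewrite eqxx.
have [rs Ers] := closed_field_poly_normal ('X^m - 1 : {poly K}).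
have lc : lead_coef ('X^m - 1 : {poly K}) = 1 by apply/eqP; rewrite lead_coefXnsubC.
rewrite lc scale1r in Ers.
have U : uniq rs by rewrite -separable_prod_XsubC -Ers separable_Xn_sub_1.
have A : all m.-unity_root rs.
  by apply/allP => x xrs; rewrite unity_rootE -subr_eq0; have := root_prod_XsubC rs x;
     rewrite -Ers xrs => /rootP; rewrite !hornerE => ->.
have S : (m <= size rs)%N.
  by rewrite -ltnS -(size_prod_XsubC rs id) -Ers size_XnsubC.
by have /hasP[z _ zP] := has_prim_root mpos A U S; exists z.
Qed.

Section Frobenius.
Variables (K : fieldType) (q : nat).
Hypotheses (charK : [pchar K].-nat q).

Lemma torus_phi_Frobenius (u v : K) :
  torus_phi (u ^+ q, v ^+ q) = ((torus_phi (u, v)).1 ^+ q, (torus_phi (u, v)).2 ^+ q).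
Proof.
rewrite /torus_phi /= !exprDn_pchar // !(exprMn, exprVn).
by [].
Qed.

Lemma torus_orbit_Frobenius (u v : K) : u != 0 -> v != 0 ->
  (u ^+ q, v ^+ q) \in torus_orbit (u, v) -> u ^+ (q ^ 6) = u /\ v ^+ (q ^ 6) = v.
Proof.
move=> u0 v0 H.
have it (x : K) : x ^+ (q ^ 6) = x ^+ q ^+ q ^+ q ^+ q ^+ q ^+ q.
  by rewrite -!exprM; congr (_ ^+ _); ring.
rewrite !it; move: H; rewrite !inE !xpair_eqE.
do 11?[case/orP]; move=> /andP[/= /eqP Eu /eqP Ev]; rewrite !(exprMn, exprVn, Eu, Ev);
  by split; field; rewrite ?u0 ?v0 ?oner_eq0.
Qed.
End Frobenius.

Section ExponentialZp.
Variables (K : fieldType) (N : nat) (z : K).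
Hypotheses (N_gt1 : (1 < N)%N) (zP : N.-primitive_root z).
Local Notation V := 'Z_N.

Definition zexp (i : V) : K := z ^+ i.
Definition zexp2 (s : V * V) : K * K := (zexp s.1, zexp s.2).

Lemma zexpD (i j : V) : zexp (i + j) = zexp i * zexp j.
Proof.
rewrite /zexp -[i in LHS]natr_Zp -[j in LHS]natr_Zp -natrD val_Zp_nat //.
by rewrite prim_expr_mod // exprD.
Qed.

Lemma zexp_neq0 (i : V) : zexp i != 0.
Proof.
by rewrite expf_neq0 //; apply/eqP => z0; have := prim_expr_order zP;
  rewrite z0 expr0n -[N]prednK ?(ltnW N_gt1) //= => /eqP; rewrite eq_sym oner_eq0.
Qed.

Lemma zexp0 : zexp 0 = 1. Proof. by []. Qed.

Lemma zexpN (i : V) : zexp (- i) = (zexp i)^-1.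
Proof. by apply: (mulIf (zexp_neq0 i)); rewrite -zexpD addNr zexp0 mulVf ?zexp_neq0. Qed.

Lemma zexpMn (m : nat) (i : V) : zexp (m%:R * i) = zexp i ^+ m.
Proof.
elim: m => [|m IHm]; first by rewrite mul0r.
by rewrite -natr1 mulrDl mul1r zexpD IHm exprSr.
Qed.

Lemma zexp_inj : injective zexp.
Proof.
move=> i j /eqP; rewrite (eq_prim_root_expr zP) !modn_small ?Zp_ltn // => /eqP.
exact: val_inj.
Qed.

Lemma zexp2_inj : injective zexp2.
Proof. by move=> [i j] [i' j'] [/zexp_inj -> /zexp_inj ->]. Qed.

Lemma zexp_surj (u : K) : u ^+ N = 1 -> exists i, u = zexp i.
Proof.
move=> /(prim_rootP zP)[i ->]; exists i%:R.
by rewrite /zexp val_Zp_nat // modn_small.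
Qed.

Lemma zexp2_orbit (s : V * V) : torus_orbit (zexp2 s) = map zexp2 (add_orbit s).
Proof. exact: (@orbit_of_morph V K +%R -%R *%R GRing.inv zexp s zexpD zexpN). Qed.

Lemma torus_phi_zexp2 (s t : V * V) :
  (torus_phi (zexp2 t) == torus_phi (zexp2 s)) = (t \in add_orbit s).
Proof.
rewrite -(mem_map zexp2_inj) -zexp2_orbit; apply/eqP/idP.
  by apply: torus_phi_inj; apply: zexp_neq0.
by apply: torus_phi_orbit; apply: zexp_neq0.
Qed.
End ExponentialZp.

Lemma add_orbit_scale (V : comNzRingType) (c : V) (r t : V * V) :
  t \in add_orbit (c * r.1, c * r.2) ->
  exists2 r', r' \in add_orbit r & t = (c * r'.1, c * r'.2).
Proof.
rewrite (@orbit_of_morph V V +%R -%R +%R -%R (fun x => c * x) r (mulrDr c) (mulrN c)).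
by case/mapP => r' ? ->; exists r'.
Qed.

Lemma torsion_count_orbit (k q : nat) (s t : 'Z_(q ^ 6 - 1) * 'Z_(q ^ 6 - 1)) :
  (0 < k)%N -> (1 < q)%N -> t \in add_orbit s ->
  (0 < torsion_count k s)%N -> (0 < torsion_count k t)%N.
Proof.
move=> k0 q1 ts /(torsion_count_gt0 k0 q1)[r Er Qr]; apply/(torsion_count_gt0 k0 q1).
rewrite Er in ts; have [r' r'r ->] := add_orbit_scale ts; exists r' => //.
rewrite (perm_mem (add_orbit_perm r'r)) -(perm_mem (add_orbit_perm Qr)).
rewrite (@orbit_of_morph _ _ +%R -%R +%R -%R (fun x => q%:R * x) r (mulrDr _) (mulrN _)).
by apply/mapP; exists r'.
Qed.

Lemma card_value_set (R : realType) (p n q k : nat) (F : finFieldType) G :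
  prime p -> (0 < n)%N -> q = (p ^ n)%N -> #|F| = q -> (0 < k)%N ->
  is_G2_folding R k G ->
  (12 * #|@polymap F G @: [set: F * F]|
   = \sum_(s : 'Z_(q ^ 6 - 1) * 'Z_(q ^ 6 - 1))
       (0 < torsion_count k s)%N * count_mem s (add_orbit s))%N.
Proof.
move=> pr n0 Eq cF k0 folG.
have q1 : (1 < q)%N by rewrite -cF finNzRing_gt1.
have N1 := torsion_order_gt1 k0 q1.
have pF : p \in [pchar F] by apply: (card_finPcharP (n := n)); rewrite // cF.
have [K [inj _]] := countable_algebraic_closure F.
have pK := rmorph_pchar inj pF.
have charK : [pchar K].-nat q by rewrite (eq_pnat _ (pcharf_eq pK)) Eq pnatX pnat_id ?orbT.
have qK : q%:R = 0 :> K.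
  by rewrite Eq natrX (pcharf0 pK) expr0n -[n]prednK.
have [z zP] : exists z : K, (q ^ 6 - 1).-primitive_root z.
  apply: prim_root_closed; rewrite natrB ?expn_gt0 ?(ltnW q1) // natrX qK expr0n /= sub0r.
  by rewrite oppr_eq0 oner_eq0.
pose inj2 (x : F * F) : K * K := (inj x.1, inj x.2).
have inj2I : injective inj2 by move=> [? ?] [? ?] [/fmorph_inj -> /fmorph_inj ->].
have fixF (x : F) : inj x ^+ q = inj x by rewrite -rmorphXn -cF expf_card.
have Ffix (y : K) : y ^+ q = y -> exists x, y = inj x.
  move=> yq; have := congr1 (fun P => (map_poly inj P).[y]) (finField_genPoly F).
  rewrite cF rmorphB rmorph_prod /= map_polyXn map_polyX !hornerE yq subrr horner_prod.
  move/esym/eqP/prodf_eq0 => [x _]; rewrite rmorphB /= map_polyX map_polyC !hornerE subr_eq0.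
  by move/eqP->; exists x.
pose S := [pred s : 'Z_(q ^ 6 - 1) * 'Z_(q ^ 6 - 1) | (0 < torsion_count k s)%N].
pose tp (s : 'Z_(q ^ 6 - 1) * 'Z_(q ^ 6 - 1)) := torus_phi (zexp2 z s).
have tpE s t : (tp t == tp s) = (t \in add_orbit s) by apply: torus_phi_zexp2.
have foldE s : polymap G (tp s) = tp (k%:R * s.1, k%:R * s.2).
  by rewrite /tp (polymap_torus folG) ?zexp_neq0 // /zexp2 !zexpMn.
have frobE s : tp (q%:R * s.1, q%:R * s.2) = ((tp s).1 ^+ q, (tp s).2 ^+ q).
  by rewrite /tp /zexp2 !zexpMn // torus_phi_Frobenius.
have injG x : inj2 (polymap G x) = polymap G (inj2 x) by rewrite /inj2 polymap_rmorph.
have imP y : reflect (exists2 s, S s & inj2 y = tp s) (y \in @polymap F G @: [set: F * F]).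
  apply: (iffP imsetP) => [[x _ ->]|[s /(torsion_count_gt0 k0 q1)[r Er Qr] Ey]].
    have [[u v] [/= u0 v0 Ex]] := torus_phi_surj (inj2 x).
    have fx : torus_phi (u ^+ q, v ^+ q) = torus_phi (u, v).
      by rewrite torus_phi_Frobenius // Ex /= !fixF.
    have O : (u ^+ q, v ^+ q) \in torus_orbit (u, v).
      by apply: torus_phi_inj; rewrite /= ?expf_neq0.
    have [uN vN] := torus_orbit_Frobenius u0 v0 O.
    have root1 (w : K) : w != 0 -> w ^+ (q ^ 6) = w -> w ^+ (q ^ 6 - 1) = 1.
      move=> w0 wq; apply: (mulfI w0); rewrite mulr1 -exprS subn1 prednK //.
      by rewrite expn_gt0 ltnW.
    have [i Ei] := zexp_surj N1 zP (root1 _ u0 uN); have [j Ej] := zexp_surj N1 zP (root1 _ v0 vN).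
    have Er : inj2 x = tp (i, j) by rewrite -Ex Ei Ej.
    exists (k%:R * i, k%:R * j); last by rewrite injG Er foldE.
    apply/(torsion_count_gt0 k0 q1); exists (i, j) => //.
    by rewrite -tpE frobE -Er /= !fixF.
  have fr : ((tp r).1 ^+ q, (tp r).2 ^+ q) = tp r by apply/eqP; rewrite -frobE tpE.
  have [x1 Ex1] : exists x, (tp r).1 = inj x by apply: Ffix; case: (tp r) fr => ? ? [].
  have [x2 Ex2] : exists x, (tp r).2 = inj x by apply: Ffix; case: (tp r) fr => ? ? [].
  exists (x1, x2) => //; apply: inj2I; rewrite injG Ey Er -foldE; congr polymap.
  by rewrite [LHS]surjective_pairing Ex1 Ex2.
set Im := (_ @: _)%SET in imP *.
pose f y := odflt 0 [pick s | S s && (inj2 y == tp s)].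
have fP y : y \in Im -> S (f y) /\ inj2 y = tp (f y).
  move/imP => [s Ss Ey]; rewrite /f; case: pickP => [t /andP[St /eqP]//|/(_ s)].
  by rewrite Ss Ey eqxx.
have cnt y : y \in Im -> (\sum_s (S s && (inj2 y == tp s)) * count_mem s (add_orbit s) = 12)%N.
  move/fP => [Sf ->]; rewrite -[RHS](sum_count_mem (add_orbit (f y))).
  apply: eq_bigr => s _; rewrite eq_sym tpE.
  case: (boolP (s \in _)) => [sO|sO]; last first.
    by rewrite andbF mul0n; apply/esym/count_memPn.
  have -> : S s by apply: torsion_count_orbit Sf.
  by rewrite mul1n (permP (add_orbit_perm sO)).
rewrite mulnC -sum_nat_const -(eq_bigr _ (fun y yI => cnt y yI)) exchange_big /=.
apply: eq_bigr => s _; rewrite -big_distrl /=; congr (_ * _)%N.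
rewrite -[(0 < _)%N]/(S s); case: (boolP (S s)) => /= [Ss|_]; last by rewrite big1.
have [x Ex] : exists x, inj2 x = tp s.
  have /(torsion_count_gt0 k0 q1)[r Er Qr] := Ss.
  have fr : ((tp r).1 ^+ q, (tp r).2 ^+ q) = tp r by apply/eqP; rewrite -frobE tpE.
  have [x1 Ex1] : exists x, (tp r).1 = inj x by apply: Ffix; case: (tp r) fr => ? ? [].
  have [x2 Ex2] : exists x, (tp r).2 = inj x by apply: Ffix; case: (tp r) fr => ? ? [].
  exists (polymap G (x1, x2)); rewrite injG Er -foldE; congr polymap.
  by rewrite [RHS]surjective_pairing Ex1 Ex2.
have xI : x \in Im by apply/imP; exists s.
rewrite (bigD1 x) //= Ex eqxx big1 ?addn0 // => y /andP[_ yx].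
by rewrite -Ex (inj_eq inj2I) (negPf yx).
Qed.

Theorem theorem3p1 (R : realType) (p n q k : nat) (F : finFieldType)
    (G : {poly {poly int}} * {poly {poly int}}) :
  prime p -> (0 < n)%N -> q = (p ^ n)%N -> #|F| = q -> (0 < k)%N ->
  is_G2_folding R k G ->
  (#|@polymap F G @: [set: F * F]|)%:R
    = (a_ k q)%:R ^+ 2 / 12 + (at_ k q)%:R ^+ 2 / 12 + (b_ k q)%:R / 2
      + (c_ k q)%:R / 6 + (ct_ k q)%:R / 6 + eta k q
  /\ (gcdn k 6 = 1%N -> eta k q = 0).
Proof.
move=> pr n0 Eq cF k0 folG; have q1 : (1 < q)%N by rewrite -cF finNzRing_gt1.
split.
  apply: value_set_formula => //.
  by rewrite (card_value_set pr n0 Eq cF k0 folG) count_identity.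
move=> k6; have k2 : (2 %| k)%N = false.
  by apply/negP => k2; have := dvdn_gcd 2 k 6; rewrite k6 k2.
have k3 : (3 %| k)%N = false.
  by apply/negP => k3; have := dvdn_gcd 3 k 6; rewrite k6 k3.
by rewrite /eta k2 k3.
Qed.
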